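(* For every $\varepsilon>0$ there exists $\kappa_0=\kappa_0(\varepsilon)<0$ such that for all $\kappa\le\kappa_0$, $$(1-\varepsilon)\frac{\log 2}{\Phi(\kappa)}\le\alpha_{\mathrm{low}}(\kappa)\le\alpha_{\mathrm{up}}(\kappa)\le(1+\varepsilon)\frac{\log 2}{\Phi(\kappa)}.$$ In particular both $\alpha_{\mathrm{low}}(\kappa)$ and $\alpha_{\mathrm{up}}(\kappa)$ equal $(1+o_\kappa(1))\log 2/\Phi(\kappa)$ as $\kappa\to-\infty$.
   Context: $\Phi,\phi$ are the standard normal CDF and density; $\mathrm{Ent}(x)=-x\log x-(1-x)\log(1-x)$. For $\kappa<0$: $\alpha_{\mathrm{up}}(\kappa)=-\log2/\log(1-\Phi(\kappa))$. Let $c_*=c_*(\kappa)>0$ be the unique positive solution of $c(1-\Phi(\kappa+c))=\phi(\kappa+c)$. For $\alpha>0$, $q\in[-1,1]$, let $\Psi(q;\alpha)=\alpha\log\mathbb{E}_q[\exp(-c_*(G_1+G_2))\mathbf 1\{G_1\ge\kappa,G_2\ge\kappa\}]+\mathrm{Ent}(\frac{1+q}{2})+\log2$, where under $\mathbb{E}_q$, $(G_1,G_2)$ is centered Gaussian with unit variances and covariance $q$. Let $\alpha_{\mathrm{low}}(\kappa)=\sup\{\alpha>0:\ \Psi(\cdot;\alpha)$ is uniquely maximized on $[-1,1]$ at $q=0$ and $\partial_q^2\Psi(0;\alpha)<0\}$. *)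

(* Defs.v *)
From HB Require Import structures.
From mathcomp Require Import all_boot all_order all_algebra.
From mathcomp Require Import all_classical all_reals all_analysis.

Set Implicit Arguments.
Unset Strict Implicit.
Unset Printing Implicit Defensive.

Import Order.TTheory GRing.Theory Num.Theory.
Import numFieldNormedType.Exports.

Local Open Scope classical_set_scope.
Local Open Scope ring_scope.

Section definitions.
Context {R : realType}.
Implicit Types a c k p q : R.

Definition Phi k : R := fine (normal_prob (0 : R) 1 `]-oo, k]).

Definition phi k : R := normal_pdf 0 1 k.

(* No case split at p = 0 or p = 1: [ln 0 = 0] in the library. *)
Definition Ent p : R := - p * ln p - (1 - p) * ln (1 - p).

Definition alpha_up k : R := - ln 2 / ln (1 - Phi k).

(* For k < 0 the positive solution exists and is unique; [0] is only the
   default value of [xget]. *)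
Definition c_star k : R :=
  xget 0 [set c | 0 < c /\ c * (1 - Phi (k + c)) = phi (k + c)].

(* The centered Gaussian pair with unit variances and covariance q, degenerate
   cases q = -1 and q = 1 included, is realized as the linear image
   (x, q x + sqrt (1 - q^2) y) of a pair (x, y) of independent standard
   normals. *)
Definition std_normal2 : probability (measurableTypeR R * measurableTypeR R)%type R :=
  (normal_prob (0 : R) 1 \x normal_prob (0 : R) 1)%E.

Definition G1 (z : R * R) : R := z.1.

Definition G2 q (z : R * R) : R := q * z.1 + Num.sqrt (1 - q ^+ 2) * z.2.

Definition pair_moment k q : R :=
  fine 'E_std_normal2[fun z =>
    expR (- c_star k * (G1 z + G2 q z)) *
    \1_[set w | k <= G1 w /\ k <= G2 q w] z].

Definition Psi k a q : R :=
  a * ln (pair_moment k q) + Ent ((1 + q) / 2) + ln 2.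

Definition admissible k : set R :=
  [set a | [/\ 0 < a,
     (forall q, -1 <= q <= 1 -> q != 0 -> Psi k a q < Psi k a 0) &
     derive1n 2 (Psi k a) 0 < 0]].

(* The supremum is taken in [\bar R], so that neither an empty nor an
   unbounded set of admissible a receives a conventional finite value. *)
Definition alpha_low k : \bar R := ereal_sup [set a%:E | a in admissible k].

End definitions.

(* Main.v *)
(** Write the pair moment at correlation [q] as [F(q) = E_q[f(G1) f(G2)]] with
    [f(x) = exp(- c x) 1{x >= k}] and [c = c_star k].

    Upper bound: an admissible [a] has [Psi(1; a) < Psi(0; a)], that is,
    [a (ln F(1) - ln F(0)) < ln 2], while Cauchy-Schwarz applied to [f] and the
    indicator of its support gives [F(0) <= F(1) (1 - Phi k)]; hence
    [a < alpha_up k <= ln 2 / Phi k].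

    Lower bound: [u = f - 1] is small, [|u(x)| <= 1{x < k} + 2 c |x|] with
    [c <= 4 phi k], so that [F(q) - F(0) = U(q) - U(0)] with
    [U(q) = E_q[u(G1) u(G2)]] is at most [E u^2 = (1 + o(1)) Phi k] for every [q];
    near [|q| = 1], where the entropy is negligible, this is enough.  For [|q|]
    bounded away from 1, the second derivative of the Gaussian density in [q] is
    dominated by a product [C w(x) w(y)], [w(x) = exp (- b x^2)], [b > 1/4];
    since [U'(0) = (E[x u(x)])^2] vanishes by the choice of [c], this yields
    [|U(q) - U(0)| <= C (int |u| w)^2 q^2], and [(int |u| w)^2 = o(Phi k)] because
    [2 b > 1/2]; meanwhile the entropy deficit is at least [q^2 / 4]. *)
Require Import Defs.
From HB Require Import structures.
From mathcomp Require Import all_boot all_order all_algebra.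
From mathcomp Require Import all_classical all_reals all_analysis.
From mathcomp Require Import measurable_realfun.
From mathcomp Require Import ring lra.
Set Implicit Arguments.
Unset Strict Implicit.
Unset Printing Implicit Defensive.
Import Order.TTheory GRing.Theory Num.Theory.
Import numFieldNormedType.Exports.
Local Open Scope classical_set_scope.
Local Open Scope ring_scope.

(** * Integration against densities and affine images of Lebesgue measure *)

(** The scale a ~ ln 2 / Phi k is exponentially large in k^2, so every variation of F is measured
    against Phi k. A term of F linear in q, however small, would move the maximiser off 0; the
    equation defining c removes it. An extra constant factor in E u^2 would be just as fatal: near
    |q| = 1 the gain in a ln F is (1 - eps) ln 2 up to small errors, barely below the entropy drop
    ln 2. The leading coefficient of E u^2 is 1 because u is exactly -1 below k. Neither estimate
    covers all q. The global one is useless near 0, where the entropy deficit is only of order q^2.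
    The quadratic one degenerates as r tends to 1: C blows up and b falls to 1/4, where (int |u|
    w)^2 would have the same Gaussian rate exp (- k^2 / 2) as Phi k. Hence the order of choices: eps
    fixes r through the entropy, r fixes b and C, and only then does k tend to -oo. *)

Section density.
Context d (T : measurableType d) (R : realType).
Variables (mu nu : {measure set T -> \bar R}) (g : T -> R).
Hypothesis g0 : forall x, 0 <= g x.
Hypothesis mg : measurable_fun [set: T] g.
Hypothesis nuE : forall A, measurable A -> nu A = (\int[mu]_(x in A) (g x)%:E)%E.
Local Open Scope ereal_scope.

Import HBNNSimple.

Lemma integral_density_nnsfun (h : {nnsfun T >-> R}) :
  \int[nu]_x (h x)%:E = \int[mu]_x ((h x)%:E * (g x)%:E).
Proof.
under [LHS]eq_integral do rewrite fimfunE -fsumEFin//.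
rewrite [LHS]ge0_integral_fsum//; last 2 first.
  - by move=> r; exact/measurable_EFinP/measurableT_comp.
  - by move=> n x _; rewrite EFinM nnfun_muleindic_ge0.
under [RHS]eq_integral.
  move=> x xD; rewrite muleC fimfunE -fsumEFin// ge0_mule_fsumr; last first.
    by move=> r; rewrite EFinM nnfun_muleindic_ge0.
  over.
rewrite [RHS]ge0_integral_fsum//; last 2 first.
  - move=> r; apply: emeasurable_funM; first exact/measurable_EFinP.
    exact/measurable_EFinP/measurableT_comp.
  - move=> n x _; apply: mule_ge0; first by rewrite lee_fin.
    by rewrite EFinM nnfun_muleindic_ge0.
apply: eq_fsbigr => r; rewrite inE/= => -[t _ <-{r}].
have mh : measurable (h @^-1` [set h t]) by exact: measurable_sfunP.
under eq_integral do rewrite EFinM.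
rewrite ge0_integralZl//; last 2 first.
  - exact/measurable_EFinP/measurable_indic.
  - by rewrite lee_fin.
rewrite integral_indic// setIT nuE//.
under [RHS]eq_integral do rewrite EFinM muleCA.
rewrite ge0_integralZl//; last 3 first.
  - apply: emeasurable_funM; first exact/measurable_EFinP.
    exact/measurable_EFinP/measurable_indic.
  - by move=> x _; rewrite mule_ge0// lee_fin.
  - by rewrite lee_fin.
congr (_ * _); rewrite integral_mkcond/=; apply: eq_integral => x _.
rewrite patchE indicE; case: ifPn => xh; first by rewrite mule1.
by rewrite mule0.
Qed.

(** [nuE] prescribes [nu] on sets only; simple functions and then monotone convergence carry it to
    nonnegative functions. *)
Lemma ge0_integral_density (f : T -> \bar R) :
  measurable_fun setT f -> (forall x, 0 <= f x) ->
  \int[nu]_x f x = \int[mu]_x (f x * (g x)%:E).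
Proof.
move=> mf f0; pose h := nnsfun_approx measurableT mf.
have fE x : f x = limn (EFin \o h ^~ x).
  by apply/esym/cvg_lim => //; apply: cvg_nnsfun_approx.
transitivity (limn (fun n => \int[nu]_x (h n x)%:E)).
  rewrite -monotone_convergence//.
  - by apply: eq_integral => x _; rewrite fE.
  - by move=> n; exact/measurable_EFinP.
  - by move=> n x _; rewrite lee_fin.
  - by move=> x _ a b ab; rewrite lee_fin; exact/lefP/nd_nnsfun_approx.
under eq_fun do rewrite integral_density_nnsfun.
rewrite -monotone_convergence//.
- apply: eq_integral => x _.
  rewrite fE muleC -limeMl//; first by congr (limn _); apply/funext => n /=; rewrite muleC.
  apply: ereal_nondecreasing_is_cvgn => a b ab; rewrite lee_fin.
  exact/lefP/nd_nnsfun_approx.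
- by move=> n; apply: emeasurable_funM; exact/measurable_EFinP.
- by move=> n x _; rewrite mule_ge0// lee_fin.
- move=> x _ a b ab; rewrite lee_wpmul2r ?lee_fin//.
  exact/lefP/nd_nnsfun_approx.
Qed.

End density.

Section normal1.
Context {R : realType}.
Notation lam := (@lebesgue_measure R).
Implicit Types (m s : R).

Lemma ge0_integral_normal_prob m s (f : R -> \bar R) :
  measurable_fun setT f -> (forall x, 0 <= f x)%E ->
  (\int[normal_prob m s]_x f x = \int[lam]_x (f x * (normal_pdf m s x)%:E))%E.
Proof.
move=> mf f0; apply: ge0_integral_density => //.
- exact: normal_pdf_ge0.
- exact: measurable_normal_pdf.
Qed.

Lemma measurable_affine m s : measurable_fun [set: R] (fun y => m + s * y).
Proof. by apply: measurable_funD => //; apply: measurable_funM. Qed.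

(** By uniqueness of Lebesgue measure, agreement on half-open intervals is enough. A negative slope
    turns []a, b]] into an interval closed on the left instead, whose length is computed in the same
    way. *)
Lemma lebesgue_measure_affine m s (A : set R) : s != 0 -> measurable A ->
  lam A = (`|s|%:E * lam ((fun y : R => m + s * y)%R @^-1` A))%E.
Proof.
move=> s0 mA.
have s1 : 0 < `|s| by rewrite normr_gt0.
pose T : measurableTypeR R -> measurableTypeR R := fun y => m + s * y.
have mT : measurable_fun setT T by exact: measurable_affine.
pose ms := NngNum (ltW s1).
pose nu := mscale ms (pushforward lam T).
have : lam A = (nu mT : {measure set _ -> \bar R}) A.
  apply: (@lebesgue_measure_unique R (nu mT)) => //= _ [[a b] /= ab <-].
  rewrite /nu /mscale/= /pushforward/=.
  have [sp|sn] := ltP 0 s.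
    have -> : T @^-1` `]a, b] = `](a - m) / s, (b - m) / s]%classic.
      apply/seteqP; split=> y /=; rewrite !in_itv/= ltr_pdivrMr// ler_pdivlMr// /T;
      rewrite ltrBlDl lerBrDl [y * s]mulrC//.
    rewrite lebesgue_measure_itv/= lte_fin lebesgue_measure_itv/= lte_fin.
    rewrite ltr_pM2r ?invr_gt0// ltrD2r.
    case: ifPn => _; last by rewrite mule0.
    rewrite -!EFinB -EFinM gtr0_norm//; congr EFin; field.
    by rewrite gt_eqF.
  have {}sn : s < 0 by rewrite lt_neqAle s0.
  have -> : T @^-1` `]a, b] = `[(b - m) / s, (a - m) / s[%classic.
    apply/seteqP; split=> y /=; rewrite !in_itv/= ltr_ndivlMr// ler_ndivrMr// /T;
    by rewrite ltrBlDl lerBrDl [y * s]mulrC andbC.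
  rewrite lebesgue_measure_itv/= lte_fin lebesgue_measure_itv/= lte_fin.
  rewrite ltr_nM2r ?invr_lt0// ltrD2r.
  case: ifPn => _; last by rewrite mule0.
  rewrite -!EFinB -EFinM ltr0_norm//; congr EFin; field.
  by rewrite lt_eqF.
by [].
Qed.

Lemma ge0_integral_affine m s (f : R -> \bar R) : s != 0 ->
  measurable_fun setT f -> (forall x, 0 <= f x)%E ->
  (\int[lam]_x f x = `|s|%:E * \int[lam]_y f (m + s * y)%R)%E.
Proof.
move=> s0 mf f0.
have s1 : 0 < `|s| by rewrite normr_gt0.
pose T : measurableTypeR R -> measurableTypeR R := fun y => m + s * y.
have mT : measurable_fun setT T by exact: measurable_affine.
pose ms := NngNum (ltW s1).
pose nu := mscale ms (pushforward lam T).
transitivity (\int[nu mT]_x f x)%E.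
  apply: eq_measure_integral => A mA _.
  exact: (lebesgue_measure_affine m s0 mA).
rewrite ge0_integral_mscale// ge0_integral_pushforward//.
Qed.

End normal1.

(** * The law of a correlated Gaussian pair *)

Section bivariate.
Context {R : realType}.
Notation lam := (@lebesgue_measure R).
Notation N := (normal_prob (0 : R) 1).
Implicit Types (q : R).

(** The factor [1 / sqrt (1 - q^2)] of the density is absorbed into the exponent as a logarithm: the
    density is then a single exponential in [q], and differentiation only multiplies it by the
    derivative of the exponent. *)
Definition bvn_exponent q (z : R * R) : R :=
  - (ln (1 - q ^+ 2)) / 2
  - (z.1 ^+ 2 - 2 * q * z.1 * z.2 + z.2 ^+ 2) / (2 * (1 - q ^+ 2)).

Definition bvn_pdf q (z : R * R) : R := (2 * pi)^-1 * expR (bvn_exponent q z).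

Lemma bvn_pdf_ge0 q z : 0 <= bvn_pdf q z.
Proof. by rewrite mulr_ge0 ?expR_ge0// invr_ge0 mulr_ge0// pi_ge0. Qed.

Lemma bvn_pdfC q x y : bvn_pdf q (x, y) = bvn_pdf q (y, x).
Proof.
rewrite /bvn_pdf /bvn_exponent/=.
have -> : y ^+ 2 - 2 * q * y * x + x ^+ 2 = x ^+ 2 - 2 * q * x * y + y ^+ 2 by ring.
by [].
Qed.

Lemma measurable_bvn_pdf q : measurable_fun [set: R * R] (bvn_pdf q).
Proof.
apply: measurable_funM => //; apply: measurableT_comp => //.
apply: measurable_funB => //; apply: measurable_funM => //.
apply: measurable_funD.
  apply: measurable_funB; first exact: measurable_funX.
  by apply: measurable_funM => //; apply: measurable_funM.
exact: measurable_funX.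
Qed.

Lemma measurable_EFin_normal_pdf m s :
  measurable_fun [set: R] (fun x => (normal_pdf m s x)%:E).
Proof. by apply/measurable_EFinP; exact: measurable_normal_pdf. Qed.

Lemma measurable_EFin_bvn_pdf q :
  measurable_fun [set: R * R] (fun z => (bvn_pdf q z)%:E).
Proof. by apply/measurable_EFinP; exact: measurable_bvn_pdf. Qed.

Lemma measurable_EFin_bvn_pdf1 q x :
  measurable_fun [set: R] (fun y => (bvn_pdf q (x, y))%:E).
Proof. exact: (measurableT_comp (measurable_EFin_bvn_pdf q) (measurable_pair1 x)). Qed.

Lemma measurable_EFin_bvn_pdf2 q y :
  measurable_fun [set: R] (fun x => (bvn_pdf q (x, y))%:E).
Proof. exact: (measurableT_comp (measurable_EFin_bvn_pdf q) (measurable_pair2 y)). Qed.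

Lemma sqrt_expR_ln (x : R) : 0 < x -> Num.sqrt x = expR (ln x / 2).
Proof.
move=> x0; apply/eqP; rewrite -(@eqrXn2 _ 2) ?sqrtr_ge0 ?expR_ge0//.
by rewrite sqr_sqrtr ?ltW// -expRM_natl mulrC divfK// lnK.
Qed.

(** Marginal of the first coordinate times conditional law of the second, which given [x] is normal
    with mean [q * x] and variance [1 - q^2]. The computation is the completed square [x^2 - 2 q x y
    + y^2 = (1 - q^2) x^2 + (y - q x)^2]. *)
Lemma bvn_pdfE q x y : q ^+ 2 < 1 ->
  normal_pdf 0 1 x * normal_pdf (q * x) (Num.sqrt (1 - q ^+ 2)) y =
  bvn_pdf q (x, y).
Proof.
rewrite -subr_gt0 => q1; set v := 1 - q ^+ 2 in q1 *.
have s0 : Num.sqrt v != 0 by rewrite gt_eqF// sqrtr_gt0.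
rewrite !normal_pdfE//= /normal_peak /normal_fun.
rewrite sqr_sqrtr ?ltW// mulrACA -expRD /bvn_pdf -/v expr1n mul1r.
have -> : bvn_exponent q (x, y) =
   - (ln v) / 2 - (x ^+ 2 - 2 * q * x * y + y ^+ 2) / (2 * v) by [].
have sE : expR (- (ln v) / 2) = (Num.sqrt v)^-1.
  by rewrite mulNr expRN -sqrt_expR_ln.
rewrite [in RHS]expRD sE mulrA -invfM; congr (_ * expR _).
- rewrite -invfM; congr (_^-1).
  have p0 : 0 <= pi *+ 2 :> R by rewrite mulrn_wge0// pi_ge0.
  rewrite -mulrnAr sqrtrM ?(ltW q1)// mulrCA mulrA -mulrA -expr2 sqr_sqrtr//.
  by rewrite mulrC mulr_natl.
- have v0 : v != 0 by rewrite gt_eqF.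
  have -> : x ^+ 2 - 2 * q * x * y + y ^+ 2 = v * x ^+ 2 + (y - q * x) ^+ 2.
    by rewrite /v; ring.
  have E (a b w : R) : w != 0 ->
      - a ^+ 2 / (1 *+ 2) + - b ^+ 2 / (w *+ 2) =
      - ((w * a ^+ 2 + b ^+ 2) / (2 * w)).
    by move=> w0; rewrite !mulr2n; field; rewrite ?w0 -?mulr2n ?mulrn_eq0.
  by rewrite subr0 -E.
Qed.

(** For fixed [x], the affine substitution sending [y] to [q x + s y] has Jacobian [s], which
    cancels the factor [1 / s] of the conditional density. *)
Lemma ge0_integral_bvn q (f : R * R -> \bar R) : q ^+ 2 < 1 ->
  measurable_fun setT f -> (forall z, 0 <= f z)%E ->
  (\int[std_normal2]_z f (z.1, G2 q z) =
   \int[lam \x lam]_z (f z * (bvn_pdf q z)%:E))%E.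
Proof.
move=> q1 mf f0; set s := Num.sqrt (1 - q ^+ 2).
have s0 : 0 < s by rewrite sqrtr_gt0 subr_gt0.
have mg : measurable_fun setT (fun z : R * R => (z.1, G2 q z)).
  apply: measurable_fun_pair => //=; rewrite /G2.
  by apply: measurable_funD; apply: measurable_funM.
have mfg : measurable_fun setT (fun z : R * R => f (z.1, G2 q z)).
  exact: measurableT_comp.
rewrite /std_normal2 fubini_tonelli1//.
rewrite ge0_integral_normal_prob; last 2 first.
  - exact: measurable_fun_fubini_tonelli_F.
  - by move=> x; apply: integral_ge0.
have mfp : measurable_fun setT (fun z => f z * (bvn_pdf q z)%:E)%E.
  apply: emeasurable_funM => //.
  exact: measurable_EFin_bvn_pdf.
rewrite fubini_tonelli1//; last first.
  by move=> z; rewrite mule_ge0// lee_fin bvn_pdf_ge0.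
apply: eq_integral => x _; rewrite /fubini_F/=.
have mfx : measurable_fun setT (fun y => f (x, y)).
  apply: measurableT_comp => //.
rewrite ge0_integral_normal_prob//; last first.
  exact: (measurableT_comp mfg (measurable_pair1 x)).
rewrite -ge0_integralZr//; last 3 first.
  - apply: emeasurable_funM; first exact: (measurableT_comp mfg (measurable_pair1 x)).
    exact: measurable_EFin_normal_pdf.
  - by move=> y _; rewrite mule_ge0// lee_fin normal_pdf_ge0.
  - by rewrite lee_fin normal_pdf_ge0.
rewrite [RHS](@ge0_integral_affine _ (q * x) s _) ?gt_eqF//; last 2 first.
  - by apply: emeasurable_funM; [exact: mfx|exact: measurable_EFin_bvn_pdf1].
  - by move=> y; rewrite mule_ge0// lee_fin bvn_pdf_ge0.
rewrite -[RHS]ge0_integralZl//; last 2 first.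
  - apply: emeasurable_funM.
      exact: (measurableT_comp mfg (measurable_pair1 x)).
    apply: (measurableT_comp (measurable_EFin_bvn_pdf1 q x)).
    exact: measurable_affine.
  - by move=> y _; rewrite mule_ge0// lee_fin bvn_pdf_ge0.
apply: eq_integral => y _; rewrite /G2/= -/s.
rewrite -muleA [RHS]muleCA; congr (_ * _)%E; rewrite -!EFinM; congr EFin.
rewrite -bvn_pdfE// -/s [LHS]mulrC mulrCA; congr (_ * _).
rewrite !normal_pdfE ?gt_eqF//= mulrA /normal_fun /normal_peak; congr (_ * expR _).
  rewrite expr1n mul1r -[s ^+ 2 * pi *+ 2]mulrnAr sqrtrM ?sqr_ge0// sqrtr_sqr.
  by rewrite invfM mulrA divff ?mul1r// normr_eq0 gt_eqF.
rewrite addrAC subrr add0r subr0; field.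
by rewrite gt_eqF.
Qed.

(** At [|q| = 1] there is no density: [G2 q] is [z.1] up to sign, and the normal law is even.
    Otherwise the symmetry of [bvn_pdf] allows conditioning on the second coordinate instead, after
    which the first one integrates out. *)
Lemma ge0_integral_G2 q (f : R -> \bar R) : -1 <= q <= 1 ->
  measurable_fun setT f -> (forall z, 0 <= f z)%E ->
  (\int[std_normal2]_z f (G2 q z) = \int[N]_x f x)%E.
Proof.
move=> qI mf f0.
have q21 : q ^+ 2 <= 1 by nra.
move: (q21); rewrite le_eqVlt => /predU1P[q2|q2].
- have -> : G2 q = (fun z => q * z.1).
    by apply/funext => z; rewrite /G2 q2 subrr sqrtr0 mul0r addr0.
  have q0 : q != 0 by apply: contra_eq_neq q2 => ->; rewrite expr0n/= eq_sym oner_eq0.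
  have q1 : `|q| = 1 by apply/eqP; rewrite -(@eqrXn2 _ 2)// expr1n real_normK ?num_real// q2.
  have mq : measurable_fun setT (fun x : R => f (q * x)).
    by apply: measurableT_comp => //; exact: measurable_funM.
  rewrite /std_normal2 fubini_tonelli1//; last first.
    by apply: (measurableT_comp mq).
  rewrite /fubini_F/=.
  under eq_integral do rewrite integral_cst//= probability_setT mule1.
  rewrite !ge0_integral_normal_prob//.
  rewrite [RHS](@ge0_integral_affine _ 0 q _)//; last 2 first.
    - by apply: emeasurable_funM => //; exact: measurable_EFin_normal_pdf.
    - by move=> y; rewrite mule_ge0// lee_fin normal_pdf_ge0.
  rewrite q1 mul1e; apply: eq_integral => x _; rewrite add0r.
  congr (_ * _%:E)%E; rewrite !normal_pdfE//= /normal_fun !subr0.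
  by rewrite exprMn q2 mul1r.
- rewrite (@ge0_integral_bvn q (fun z => f z.2))//; last exact: measurableT_comp.
  rewrite fubini_tonelli2; last 2 first.
    - apply: emeasurable_funM; first exact: measurableT_comp.
      exact: measurable_EFin_bvn_pdf.
    - by move=> z; rewrite mule_ge0// lee_fin bvn_pdf_ge0.
  rewrite ge0_integral_normal_prob//; apply: eq_integral => y _.
  rewrite /fubini_G/=.
  rewrite ge0_integralZl//; last 2 first.
    - exact: measurable_EFin_bvn_pdf2.
    - by move=> x _; rewrite lee_fin bvn_pdf_ge0.
  congr (_ * _)%E.
  under eq_integral do rewrite bvn_pdfC -bvn_pdfE// EFinM.
  rewrite ge0_integralZl//; last 3 first.
    - exact: measurable_EFin_normal_pdf.
    - by move=> x _; rewrite lee_fin normal_pdf_ge0.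
    - by rewrite lee_fin normal_pdf_ge0.
  by rewrite integral_normal_pdf mule1.
Qed.

End bivariate.

(** * Derivatives of the Gaussian density in the correlation *)

Section derive_pointwise.
Context {R : realType}.
Implicit Types (f g : R -> R) (x a b : R).

Lemma is_derive1D f g x a b : is_derive x 1 f a -> is_derive x 1 g b ->
  is_derive x 1 (fun t => f t + g t) (a + b).
Proof. exact: is_deriveD. Qed.

Lemma is_derive1N f x a : is_derive x 1 f a -> is_derive x 1 (fun t => - f t) (- a).
Proof. exact: is_deriveN. Qed.

Lemma is_derive1B f g x a b : is_derive x 1 f a -> is_derive x 1 g b ->
  is_derive x 1 (fun t => f t - g t) (a - b).
Proof. exact: is_deriveB. Qed.

Lemma is_derive1M f g x a b : is_derive x 1 f a -> is_derive x 1 g b ->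
  is_derive x 1 (fun t => f t * g t) (f x * b + a * g x).
Proof. by move=> Hf Hg; rewrite [a * _]mulrC; exact: is_deriveM. Qed.

Lemma is_derive1Ml f x a (k : R) : is_derive x 1 f a ->
  is_derive x 1 (fun t => k * f t) (k * a).
Proof. exact: is_deriveZ. Qed.

Lemma is_derive1V f x a : f x != 0 -> is_derive x 1 f a ->
  is_derive x 1 (fun t => (f t)^-1) (- a / f x ^+ 2).
Proof.
move=> f0 Hf; apply: (is_derive_eq (is_deriveV f0 Hf)).
by rewrite /GRing.scale/= !mulNr mulrC.
Qed.

Lemma is_derive1_comp_ln f x a : 0 < f x -> is_derive x 1 f a ->
  is_derive x 1 (fun t => ln (f t)) (a / f x).
Proof.
move=> f0 Hf; rewrite mulrC.
exact: (@is_derive1_comp _ (@ln R) f x _ _ (is_derive1_ln f0) Hf).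
Qed.

Lemma is_derive1_comp_expR f x a : is_derive x 1 f a ->
  is_derive x 1 (fun t => expR (f t)) (a * expR (f x)).
Proof.
move=> Hf; rewrite mulrC.
exact: (@is_derive1_comp _ (@expR R) f x _ _ (is_derive_expR _) Hf).
Qed.

Lemma is_derive1_cst (k x : R) : is_derive x 1 (fun=> k) (0 : R).
Proof. exact: is_derive_cst. Qed.

Lemma is_derive1_id x : is_derive x 1 (fun t => t) (1 : R).
Proof. exact: is_derive_id. Qed.

Lemma is_derive1_sqr x : is_derive x 1 (fun t => t ^+ 2) (2 * x).
Proof.
apply: (is_derive_eq (is_derive1M (is_derive1_id x) (is_derive1_id x))); ring.
Qed.

End derive_pointwise.

Section bvn_derivatives.
Context {R : realType}.
Implicit Types (q r : R) (z : R * R).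

(** The derivative of [bvn_exponent] in [q], that is, the logarithmic derivative of the density. *)
Definition bvn_d1 q z : R :=
  q / (1 - q ^+ 2) + z.1 * z.2 / (1 - q ^+ 2)
  - q * (z.1 ^+ 2 - 2 * q * z.1 * z.2 + z.2 ^+ 2) / (1 - q ^+ 2) ^+ 2.

(** The second derivative of [bvn_exponent]; the density itself has second derivative
    [(bvn_d1^2 + bvn_d2) * bvn_pdf]. *)
Definition bvn_d2 q z : R :=
  (1 + q ^+ 2) / (1 - q ^+ 2) ^+ 2 + 2 * q * z.1 * z.2 / (1 - q ^+ 2) ^+ 2
  - (z.1 ^+ 2 - 4 * q * z.1 * z.2 + z.2 ^+ 2) / (1 - q ^+ 2) ^+ 2
  - 4 * q ^+ 2 * (z.1 ^+ 2 - 2 * q * z.1 * z.2 + z.2 ^+ 2) / (1 - q ^+ 2) ^+ 3.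

Let dv q : is_derive q 1 (fun t : R => 1 - t ^+ 2) (0 - 2 * q).
Proof. exact: is_derive1B (is_derive1_cst 1 q) (is_derive1_sqr q). Qed.

Let dQ q x y : is_derive q 1 (fun t : R => x ^+ 2 - 2 * t * x * y + y ^+ 2)
  (- (2 * x * y)).
Proof.
have H := is_derive1D (is_derive1_cst (x ^+ 2 + y ^+ 2) q)
  (is_derive1Ml (- (2 * x * y)) (is_derive1_id q)).
have -> : (fun t : R => x ^+ 2 - 2 * t * x * y + y ^+ 2) =
  (fun t => (x ^+ 2 + y ^+ 2) + - (2 * x * y) * t).
  by apply/funext => t; ring.
by apply: (is_derive_eq H); ring.
Qed.

Lemma is_derive_bvn_exponent q z : q ^+ 2 < 1 ->
  is_derive q 1 (fun t => bvn_exponent t z) (bvn_d1 q z).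
Proof.
rewrite -subr_gt0 => q1; case: z => x y.
have v0 : 1 - q ^+ 2 != 0 by rewrite gt_eqF.
have v2 : 2 * (1 - q ^+ 2) != 0 by rewrite mulf_neq0.
have H1 := is_derive1Ml (- 2^-1) (@is_derive1_comp_ln _ (fun t => 1 - t ^+ 2) q _ q1 (dv q)).
have H2 := is_derive1M (dQ q x y) (@is_derive1V _ (fun t => 2 * (1 - t ^+ 2)) q _ v2 (is_derive1Ml 2 (dv q))).
have := is_derive1B H1 H2.
have -> : (fun t : R => - 2^-1 * ln (1 - t ^+ 2) -
    (x ^+ 2 - 2 * t * x * y + y ^+ 2) * (2 * (1 - t ^+ 2))^-1) =
    (fun t => bvn_exponent t (x, y)).
  by apply/funext => t; rewrite /bvn_exponent/= mulNr [2^-1 * _]mulrC -mulNr.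
move=> H; apply: (is_derive_eq H); rewrite /bvn_d1/=.
by field.
Qed.

Lemma is_derive_bvn_d1 q z : q ^+ 2 < 1 ->
  is_derive q 1 (fun t => bvn_d1 t z) (bvn_d2 q z).
Proof.
rewrite -subr_gt0 => q1; case: z => x y.
have v0 : 1 - q ^+ 2 != 0 by rewrite gt_eqF.
have v2 : (1 - q ^+ 2) ^+ 2 != 0 by rewrite expf_neq0.
have di := @is_derive1V _ (fun t => 1 - t ^+ 2) q _ v0 (dv q).
have H1 := is_derive1M (is_derive1_id q) di.
have H2 := is_derive1Ml (x * y) di.
have H3 := is_derive1M (is_derive1M (is_derive1_id q) (dQ q x y))
  (is_derive1M di di).
have := is_derive1B (is_derive1D H1 H2) H3.
have -> : (fun t : R => t * (1 - t ^+ 2)^-1 + x * y * (1 - t ^+ 2)^-1 -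
   t * (x ^+ 2 - 2 * t * x * y + y ^+ 2) * ((1 - t ^+ 2)^-1 * (1 - t ^+ 2)^-1))
   = (fun t => bvn_d1 t (x, y)).
  by apply/funext => t; rewrite /bvn_d1/= -invfM -expr2.
move=> H; apply: (is_derive_eq H); rewrite /bvn_d2/=.
by field.
Qed.

Lemma is_derive_bvn_pdf q z : q ^+ 2 < 1 ->
  is_derive q 1 (fun t => bvn_pdf t z) (bvn_d1 q z * bvn_pdf q z).
Proof.
move=> q1; rewrite [X in is_derive _ _ _ X]mulrCA.
exact: is_derive1Ml (is_derive1_comp_expR (is_derive_bvn_exponent z q1)).
Qed.

Lemma is_derive_bvn_d1_pdf q z : q ^+ 2 < 1 ->
  is_derive q 1 (fun t => bvn_d1 t z * bvn_pdf t z)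
    ((bvn_d1 q z ^+ 2 + bvn_d2 q z) * bvn_pdf q z).
Proof.
move=> q1.
apply: (is_derive_eq (is_derive1M (is_derive_bvn_d1 z q1) (is_derive_bvn_pdf z q1))).
by ring.
Qed.

End bvn_derivatives.

(** * Gaussian majorants for the density and its derivatives in the correlation *)

Section bvn_bounds.
Context {R : realType}.
Implicit Types (q r x y : R).

(** Square of [1 + S <= (1 + 2/t) (1 + t S / 2) <= (1 + 2/t) exp (t S / 2)]. It trades a polynomial
    prefactor for an arbitrarily small loss [t] in the Gaussian rate. *)
Lemma sqrD1_le_expR (t S : R) : 0 < t -> 0 <= S ->
  (1 + S) ^+ 2 <= (1 + 2 / t) ^+ 2 * expR (t * S).
Proof.
move=> t0 S0.
have -> : t * S = 2%:R * (t * S / 2) by field.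
have t1 : 0 <= 1 + 2 / t by rewrite addr_ge0// divr_ge0// ltW.
rewrite expRM_natl -exprMn lerXn2r ?nnegrE ?addr_ge0//.
  by rewrite mulr_ge0 ?expR_ge0.
have h : 1 + t * S / 2 <= expR (t * S / 2) by exact: expR_ge1Dx.
apply: (le_trans _ (ler_wpM2l t1 h)).
have -> : (1 + 2 / t) * (1 + t * S / 2) = 1 + S + 2 / t + t * S / 2.
  by field; rewrite gt_eqF.
have : 0 <= 2 / t by rewrite divr_ge0// ltW.
have : 0 <= t * S by rewrite mulr_ge0// ltW.
lra.
Qed.

(** Since [2 |x y| <= x^2 + y^2], the quadratic form is at least [(1 - |q|) (x^2 + y^2)], and
    dividing by [2 (1 - q^2)] leaves the rate [1 / (2 (1 + |q|))]. The prefactor uses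
    [1 - q^2 <= sqrt (1 - q^2)]. *)
Lemma bvn_pdf_le r q x y : 0 < r < 1 -> `|q| <= r ->
  bvn_pdf q (x, y) <=
  (1 - r ^+ 2)^-1 * expR (- ((2 * (1 + r))^-1 * (x ^+ 2 + y ^+ 2))).
Proof.
move=> /andP[r0 r1] qr.
have [q2 q2r] : q ^+ 2 < 1 /\ q ^+ 2 <= r ^+ 2.
  move: qr; rewrite ler_norml => /andP[? ?]; split; nra.
have r2 : r ^+ 2 < 1 by nra.
have v0 : 0 < 1 - q ^+ 2 by rewrite subr_gt0.
have e0 : 0 < 1 - r ^+ 2 by rewrite subr_gt0.
have A : (2 * pi)^-1 <= 1 :> R.
  have := @pi_ge2 R => p2; rewrite invf_le1; lra.
have B : expR (- (ln (1 - q ^+ 2)) / 2) <= (1 - r ^+ 2)^-1.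
  rewrite mulNr expRN -sqrt_expR_ln// lef_pV2 ?posrE ?sqrtr_gt0//.
  apply: (@le_trans _ _ (1 - q ^+ 2)); first by lra.
  have := sqr_sqrtr (ltW v0); have := sqrtr_ge0 (1 - q ^+ 2).
  by have := sqr_ge0 q; move: (Num.sqrt _) => s; nra.
rewrite /bvn_pdf /bvn_exponent/= expRD mulrA ler_pM ?mulr_ge0 ?expR_ge0//.
- by rewrite invr_ge0 mulr_ge0// pi_ge0.
- rewrite -[leRHS]mul1r ler_pM ?expR_ge0//.
  by rewrite invr_ge0 mulr_ge0// pi_ge0.
rewrite ler_expR lerN2 ler_pdivlMr ?mulr_gt0//.
have -> : (2 * (1 + r))^-1 * (x ^+ 2 + y ^+ 2) * (2 * (1 - q ^+ 2)) =
   (x ^+ 2 + y ^+ 2) * (1 - q ^+ 2) / (1 + r).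
  by field; rewrite gt_eqF// addr_gt0.
rewrite ler_pdivrMr ?addr_gt0//.
have : `|2 * q * x * y| <= `|q| * (x ^+ 2 + y ^+ 2).
  rewrite -!mulrA mulrCA normrM ler_wpM2l// ler_norml.
  by have := sqr_ge0 (x - y); have := sqr_ge0 (x + y); nra.
rewrite ler_norml => /andP[_ h].
have q0 : 0 <= `|q| by [].
have -> : q ^+ 2 = `|q| ^+ 2 by rewrite real_normK ?num_real.
have S0 : 0 <= x ^+ 2 + y ^+ 2 by rewrite addr_ge0 ?sqr_ge0.
move: h S0; set S := x ^+ 2 + y ^+ 2; move: `|q| q0 qr => p p0 pr h S0.
have k1 : (1 - p) * S <= x ^+ 2 - 2 * q * x * y + y ^+ 2 by rewrite /S in h *; lra.
apply: (@le_trans _ _ ((1 - p) * S * (1 + r))); last first.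
  by rewrite ler_wpM2r//; lra.
have -> : S * (1 - p ^+ 2) = (1 - p) * S * (1 + p) by ring.
by rewrite ler_wpM2l ?mulr_ge0//; lra.
Qed.

(** Term by term, with [|q| <= 1], [|x y| <= S / 2] and [1 / (1 - q^2) <= E]; since [E >= 1], every
    power of [E] may be raised to the highest one present. *)
Lemma bvn_d_le r q x y (E := (1 - r ^+ 2)^-1) (S := x ^+ 2 + y ^+ 2) :
  0 < r < 1 -> `|q| <= r ->
  `|bvn_d1 q (x, y)| <= 3 * E ^+ 2 * (1 + S) /\
  `|bvn_d2 q (x, y)| <= 12 * E ^+ 3 * (1 + S).
Proof.
move=> /andP[r0 r1] qr.
have [q2 q2r] : q ^+ 2 < 1 /\ q ^+ 2 <= r ^+ 2.
  move: qr; rewrite ler_norml => /andP[? ?]; split; nra.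
have r2 : r ^+ 2 < 1 by nra.
have v0 : 0 < 1 - q ^+ 2 by rewrite subr_gt0.
have e0 : 0 < 1 - r ^+ 2 by rewrite subr_gt0.
have iE : (1 - q ^+ 2)^-1 <= E by rewrite /E lef_pV2 ?posrE//; lra.
have i0 : 0 < (1 - q ^+ 2)^-1 by rewrite invr_gt0.
have E1 : 1 <= E by rewrite /E invf_ge1//; have := sqr_ge0 r; lra.
have q1 : `|q| <= 1 by lra.
have xyS : `|x * y| <= S / 2.
  by rewrite ler_norml /S; have := sqr_ge0 (x - y); have := sqr_ge0 (x + y); nra.
have S0 : 0 <= S by rewrite addr_ge0 ?sqr_ge0.
have qxy : `|q * (x * y)| <= S / 2.
  by rewrite normrM; apply: le_trans xyS; rewrite ler_piMl.
have QS : `|x ^+ 2 - 2 * q * x * y + y ^+ 2| <= 2 * S.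
  move: qxy; rewrite !ler_norml /S => /andP[h1 h2]; apply/andP; split; nra.
rewrite /bvn_d1 /bvn_d2/= -!exprVn.
move: (1 - q ^+ 2)^-1 iE i0 => i iE i0.
have iiE : i ^+ 2 <= E ^+ 2 by rewrite lerXn2r// nnegrE; lra.
have iiiE : i ^+ 3 <= E ^+ 3 by rewrite lerXn2r// nnegrE; lra.
have E2 : E <= E ^+ 2 by rewrite expr2 ler_peMl//; lra.
have E3 : E ^+ 2 <= E ^+ 3 by rewrite (exprS _ 2) ler_peMl ?sqr_ge0.
set Q := x ^+ 2 - 2 * q * x * y + y ^+ 2 in QS *.
have prod_le (u v U V : R) : `|u| <= U -> 0 <= v -> v <= V -> `|u * v| <= U * V.
  move=> uU v0' vV; rewrite normrM (ger0_norm v0') ler_pM//.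
have qQ : `|q * Q| <= 2 * S by rewrite normrM; apply: le_trans QS; rewrite ler_piMl.
have q2Q : `|4 * q ^+ 2 * Q| <= 8 * S.
  have -> : 4 * q ^+ 2 * Q = 4 * (q * (q * Q)) by ring.
  rewrite normrM ger0_norm// (_ : 8 * S = 4 * (2 * S)); last by ring.
  by rewrite ler_wpM2l// normrM; apply: le_trans qQ; rewrite ler_piMl.
split.
- have H1 := prod_le _ _ _ _ q1 (ltW i0) iE.
  have H2 := prod_le _ _ _ _ xyS (ltW i0) iE.
  have H3 := prod_le _ _ _ _ qQ (sqr_ge0 i) iiE.
  apply: le_trans (ler_normB _ _) _; apply: le_trans (lerD (ler_normD _ _) (lexx _)) _.
  apply: le_trans (lerD (lerD H1 H2) H3) _.
  have : S * E <= S * E ^+ 2 by rewrite ler_wpM2l.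
  have : 0 <= S * E ^+ 2 by rewrite mulr_ge0// sqr_ge0.
  have := sqr_ge0 E.
  by move: (E ^+ 2) E2 => F; nra.
- have L1 : `|1 + q ^+ 2| <= 2 by rewrite ger0_norm ?addr_ge0 ?sqr_ge0//; lra.
  have L2 : `|2 * q * x * y| <= S.
    have -> : 2 * q * x * y = 2 * (q * (x * y)) by ring.
    by rewrite normrM ger0_norm//; lra.
  have L3 : `|x ^+ 2 - 4 * q * x * y + y ^+ 2| <= 3 * S.
    have -> : x ^+ 2 - 4 * q * x * y + y ^+ 2 = Q - 2 * q * x * y by rewrite /Q; ring.
    by apply: le_trans (ler_normB _ _) _; lra.
  have H1 := prod_le _ _ _ _ L1 (sqr_ge0 i) iiE.
  have H2 := prod_le _ _ _ _ L2 (sqr_ge0 i) iiE.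
  have H3 := prod_le _ _ _ _ L3 (sqr_ge0 i) iiE.
  have H4 := prod_le _ _ _ _ q2Q (exprn_ge0 3 (ltW i0)) iiiE.
  apply: le_trans (ler_normB _ _) _; apply: le_trans (lerD (ler_normB _ _) (lexx _)) _.
  apply: le_trans (lerD (lerD (ler_normD _ _) (lexx _)) (lexx _)) _.
  apply: le_trans (lerD (lerD (lerD H1 H2) H3) H4) _.
  have : S * E ^+ 2 <= S * E ^+ 3 by rewrite ler_wpM2l.
  have : 0 <= S * E ^+ 3 by rewrite mulr_ge0// exprn_ge0//; lra.
  have := sqr_ge0 E.
  by move: (E ^+ 3) E3; move: (E ^+ 2) => F G; lra.
Qed.

(* At correlations up to [r] the density is [O(exp (- (x^2 + y^2) / (2 (1 + r))))],
   and [1 / (2 (1 + r)) > 1 / 4]: the slack pays for the polynomial prefactors of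
   the derivatives. *)
Lemma bvn_pdf_derivatives_dominated r : 0 < r < 1 ->
  exists b C : R, [/\ 4^-1 < b, 0 <= C & forall q x y, `|q| <= r ->
    let w := C * (expR (- (b * x ^+ 2)) * expR (- (b * y ^+ 2))) in
    [/\ bvn_pdf q (x, y) <= w,
      `|bvn_d1 q (x, y) * bvn_pdf q (x, y)| <= w &
      `|(bvn_d1 q (x, y) ^+ 2 + bvn_d2 q (x, y)) * bvn_pdf q (x, y)| <= w]].
Proof.
move=> r01; have /andP[r0 r1] := r01.
(* [h] is the rate supplied by [bvn_pdf_le]; [b] is the midpoint of [1/4] and [h], so that the gap
   [h - b] absorbs the polynomial factors. *)
pose h := (2 * (1 + r))^-1; pose b := (4^-1 + h) / 2.
have h4 : 4^-1 < h by rewrite /h ltf_pV2 ?posrE; lra.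
have t0 : 0 < h - b by rewrite /b; lra.
pose E := (1 - r ^+ 2)^-1; pose K := (1 + 2 / (h - b)) ^+ 2.
have e0 : 0 < 1 - r ^+ 2 by rewrite subr_gt0; nra.
have E1 : 1 <= E by rewrite /E invf_ge1//; have := sqr_ge0 r; lra.
have K0 : 0 <= K by exact: sqr_ge0.
(* [21 = 9 + 12]: the square of the bound on [bvn_d1] gives [9 E^4], the bound on [bvn_d2] at most
   [12 E^4], and the density one more factor [E]. *)
exists b, (21 * E ^+ 5 * K); split.
- by rewrite /b; lra.
- by rewrite mulr_ge0// mulr_ge0// exprn_ge0//; lra.
move=> q x y qr; set S := x ^+ 2 + y ^+ 2.
have S0 : 0 <= S by rewrite addr_ge0 ?sqr_ge0.
set w := expR (- (b * x ^+ 2)) * expR (- (b * y ^+ 2)).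
have wE : w = expR (- (b * S)) by rewrite /w -expRD /S; congr expR; ring.
have pB := bvn_pdf_le x y r01 qr; rewrite -/S -/h -/E in pB.
have [d1B d2B] := bvn_d_le x y r01 qr; rewrite -/S -/E in d1B d2B.
have key (u : R) : `|u| <= 21 * E ^+ 4 * (1 + S) ^+ 2 ->
    `|u * bvn_pdf q (x, y)| <= 21 * E ^+ 5 * K * w.
  move=> uB; rewrite normrM (ger0_norm (bvn_pdf_ge0 _ _)).
  apply: le_trans (ler_pM (normr_ge0 _) (bvn_pdf_ge0 _ _) uB pB) _.
  have -> : 21 * E ^+ 4 * (1 + S) ^+ 2 * (E * expR (- (h * S))) =
    21 * E ^+ 5 * ((1 + S) ^+ 2 * expR (- (h * S))) by ring.
  rewrite [leRHS](_ : _ = 21 * E ^+ 5 * (K * w)); last by ring.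
  have c0 : 0 <= 21 * E ^+ 5 by rewrite mulr_ge0// exprn_ge0//; lra.
  apply: ler_wpM2l => //.
  have := ler_wpM2r (expR_ge0 (- (h * S))) (sqrD1_le_expR t0 S0).
  rewrite -/K (_ : K * expR ((h - b) * S) * expR (- (h * S)) = K * w)//.
  by rewrite wE -mulrA -expRD; congr (_ * expR _); ring.
have SS : 1 + S <= (1 + S) ^+ 2 by rewrite expr2 ler_peMl; lra.
have E2 : 1 <= E ^+ 2 by rewrite exprn_ege1.
have E3 : 1 <= E ^+ 3 by rewrite exprn_ege1.
have E4 : 1 <= E ^+ 4 by rewrite exprn_ege1.
have E24 : E ^+ 2 <= E ^+ 4 by rewrite (exprD E 2 2) ler_peMl//; lra.
have E34 : E ^+ 3 <= E ^+ 4 by rewrite (exprS E 3) ler_peMl//; lra.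
split.
- have -> : bvn_pdf q (x, y) = `|1 * bvn_pdf q (x, y)|.
    by rewrite mul1r ger0_norm// bvn_pdf_ge0.
  apply: key; rewrite normr1.
  by move: (E ^+ 4) E4 => G G1; nra.
- apply: key; apply: le_trans d1B _; rewrite ler_pM//; [|lra|].
  + by rewrite mulr_ge0// sqr_ge0.
  + by move: E24 E4; move: (E ^+ 2) (E ^+ 4) => F G; lra.
- apply: key; apply: le_trans (ler_normD _ _) _.
  rewrite normrX.
  have : `|bvn_d1 q (x, y)| ^+ 2 <= (3 * E ^+ 2 * (1 + S)) ^+ 2.
    by rewrite lerXn2r// nnegrE// (le_trans _ d1B).
  have -> : (3 * E ^+ 2 * (1 + S)) ^+ 2 = 9 * (E ^+ 4 * (1 + S) ^+ 2) by ring.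
  have : 12 * E ^+ 3 * (1 + S) <= 12 * (E ^+ 4 * (1 + S) ^+ 2).
    by rewrite -mulrA ler_wpM2l// ler_pM//; lra.
  by move: d2B; lra.
Qed.

End bvn_bounds.

(** * Differentiating the pairing in the correlation *)

Section product_integral.
Context {R : realType}.
Notation lam := (@lebesgue_measure R).
Variables g h : R -> R.
Hypothesis ig : lam.-integrable setT (EFin \o g).
Hypothesis ih : lam.-integrable setT (EFin \o h).

Let mg : measurable_fun [set: R] g.
Proof. by apply/measurable_EFinP; exact: (measurable_int _ ig). Qed.

Let mh : measurable_fun [set: R] h.
Proof. by apply/measurable_EFinP; exact: (measurable_int _ ih). Qed.

Let mgh : measurable_fun [set: R * R] (fun z => (g z.1 * h z.2)%:E).
Proof.
apply/measurable_EFinP; apply: measurable_funM; exact: measurableT_comp.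
Qed.

Lemma integrable_prod :
  (lam \x lam)%E.-integrable setT (EFin \o (fun z => g z.1 * h z.2)).
Proof.
apply: (@integrable12ltyP _ _ _ _ R lam lam _ mgh).2.
have /integrableP[_ gy] := ig; have /integrableP[_ hy] := ih.
under eq_integral.
  move=> x _.
  under eq_integral do rewrite /= normrM EFinM.
  rewrite ge0_integralZl//=; last first.
    by apply/measurable_EFinP; exact: measurableT_comp.
  over.
rewrite ge0_integralZr//=; last 2 first.
- by apply/measurable_EFinP; exact: measurableT_comp.
- exact: integral_ge0.
by apply: lte_mul_pinfty => //; [exact: integral_ge0|rewrite ge0_fin_numE//; exact: integral_ge0].
Qed.

Lemma Rintegral_prod :
  \int[(lam \x lam)%E]_z (g z.1 * h z.2) = \int[lam]_x g x * \int[lam]_y h y.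
Proof.
rewrite /Rintegral -(integral12_prod_meas1 integrable_prod) /fubini_F/=.
under eq_integral.
  move=> x _.
  under eq_integral do rewrite EFinM.
  rewrite integralZl//=.
  over.
rewrite /=.
rewrite -(fineK (integrable_fin_num measurableT ih)).
by rewrite integralZr//= fineM// integrable_fin_num.
Qed.

End product_integral.

Section gaussian_dominated.
Context {R : realType}.
Notation lam := (@lebesgue_measure R).

Lemma measurable_gaussian (b : R) :
  measurable_fun [set: R] (fun x => expR (- (b * x ^+ 2))).
Proof.
apply: measurableT_comp => //; apply: measurableT_comp => //.
by apply: measurable_funM => //; exact: measurable_funX.
Qed.

Lemma integrable_gaussian (b : R) : 0 < b ->
  lam.-integrable setT (EFin \o (fun x => expR (- (b * x ^+ 2)))).
Proof.
move=> b0; pose s := Num.sqrt (2 * b)^-1.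
have s0 : s != 0 by rewrite gt_eqF// sqrtr_gt0 invr_gt0 mulr_gt0.
have p0 := normal_peak_gt0 s0.
have -> : EFin \o (fun x => expR (- (b * x ^+ 2))) =
    (fun x => (normal_peak s)^-1%:E * (normal_pdf 0 s x)%:E)%E.
  apply/funext => x /=; rewrite -EFinM normal_pdfE//= mulKf ?gt_eqF//.
  rewrite /normal_fun subr0 sqr_sqrtr ?invr_ge0 ?mulr_ge0 ?ltW//.
  congr (expR _)%:E; rewrite mulr2n; field.
  by rewrite gt_eqF.
by apply: integrableZl => //; exact: integrable_normal_pdf.
Qed.

Lemma integrable_gaussian_dominated (b C : R) (g : R -> R) : 0 < b ->
  measurable_fun setT g -> (forall x, `|g x| <= C * expR (- (b * x ^+ 2))) ->
  lam.-integrable setT (EFin \o g).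
Proof.
move=> b0 mg gC.
apply: (@le_integrable _ _ _ lam _ measurableT _
    (EFin \o (fun x => C * expR (- (b * x ^+ 2))))) => //=.
- exact/measurable_EFinP.
- by move=> x _; rewrite lee_fin (le_trans (gC x))// ler_norm.
- have -> : EFin \o (fun x => C * expR (- (b * x ^+ 2))) =
      (fun x => C%:E * (EFin \o (fun x => expR (- (b * x ^+ 2)))) x)%E.
    by apply/funext => x /=; rewrite EFinM.
  by apply: integrableZl => //; exact: integrable_gaussian.
Qed.

End gaussian_dominated.

Section pair_integral.
Context {R : realType}.
Notation lam := (@lebesgue_measure R).
Notation lam2 := (lam \x lam)%E.
Variable u : R -> R.
Hypothesis mu : measurable_fun [set: R] u.
Hypothesis u1 : forall x, `|u x| <= 1.
Implicit Types (q : R).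

Let uu (z : R * R) := u z.1 * u z.2.

Let muu : measurable_fun [set: R * R] uu.
Proof. by apply: measurable_funM; exact: measurableT_comp. Qed.

Let mv (q : R) : measurable_fun [set: R * R] (bvn_d1 q).
Proof.
apply: measurable_funB; first apply: measurable_funD => //.
- by apply: measurable_funM => //; exact: measurable_funM.
- apply: measurable_funM => //; apply: measurable_funM => //.
  apply: measurable_funD; last exact: measurable_funX.
  apply: measurable_funB; first exact: measurable_funX.
  by apply: measurable_funM => //; exact: measurable_funM.
Qed.

(** The function [U] of the overview, written against the density and hence meant for [|q| < 1]; the
    next two are its formal derivatives under the integral sign. *)
Definition pairing q : R := \int[lam2]_z (u z.1 * u z.2 * bvn_pdf q z).
Definition pairing_d1 q : R :=
  \int[lam2]_z (u z.1 * u z.2 * (bvn_d1 q z * bvn_pdf q z)).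
Definition pairing_d2 q : R :=
  \int[lam2]_z (u z.1 * u z.2 * ((bvn_d1 q z ^+ 2 + bvn_d2 q z) * bvn_pdf q z)).

Variables r b C : R.
Hypothesis r01 : 0 < r < 1.
Hypothesis b0 : 0 < b.
Hypothesis C0 : 0 <= C.
Hypothesis dom : forall q x y, `|q| <= r ->
  let w := C * (expR (- (b * x ^+ 2)) * expR (- (b * y ^+ 2))) in
  [/\ bvn_pdf q (x, y) <= w,
      `|bvn_d1 q (x, y) * bvn_pdf q (x, y)| <= w &
      `|(bvn_d1 q (x, y) ^+ 2 + bvn_d2 q (x, y)) * bvn_pdf q (x, y)| <= w].

Let w1 (x : R) := `|u x| * expR (- (b * x ^+ 2)).
(** A majorant valid for all correlations in []-r, r[] at once. It keeps [|u|] and factors over the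
    coordinates, so its integral is [C] times the square of the integral of [w1], which is small
    when [u] is. *)
Let G (z : R * R) := C * (w1 z.1 * w1 z.2).

Let iw1 : lam.-integrable setT (EFin \o w1).
Proof.
apply: (@integrable_gaussian_dominated _ b 1) => //.
  by apply: measurable_funM; [exact: measurableT_comp|exact: measurable_gaussian].
move=> x; rewrite /w1 normrM normr_id ler_pM//.
by rewrite ger0_norm ?expR_ge0.
Qed.

Let iG : lam2.-integrable setT (EFin \o G).
Proof.
have -> : EFin \o G = (fun z => C%:E * (EFin \o (fun z => w1 z.1 * w1 z.2)%R) z)%E.
  by apply/funext => z /=; rewrite EFinM.
by apply: integrableZl => //; exact: integrable_prod.
Qed.

Let G_ge0 z : 0 <= G z.
Proof. by rewrite mulr_ge0// mulr_ge0// mulr_ge0 ?expR_ge0. Qed.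

Let le_G (g : R) z :
  `|g| <= C * (expR (- (b * z.1 ^+ 2)) * expR (- (b * z.2 ^+ 2))) ->
  `|u z.1 * u z.2 * g| <= G z.
Proof.
move=> gC; rewrite !normrM /G /w1.
apply: le_trans (ler_wpM2l _ gC) _; first by rewrite mulr_ge0.
by rewrite le_eqVlt; apply/orP; left; apply/eqP; ring.
Qed.

Let integrable_uu (k : R * R -> R) : measurable_fun setT k ->
  (forall z, `|k z| <= C * (expR (- (b * z.1 ^+ 2)) * expR (- (b * z.2 ^+ 2)))) ->
  lam2.-integrable setT (EFin \o (fun z => u z.1 * u z.2 * k z)).
Proof.
move=> mk kC.
apply: (@le_integrable _ _ _ lam2 _ measurableT _ (EFin \o G)) => //=.
- by apply/measurable_EFinP; exact: measurable_funM.
- move=> z _; rewrite lee_fin; apply: le_trans (le_G (kC z)) _.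
  exact: ler_norm.
Qed.

Let rI q : `]-r, r[%classic q -> `|q| <= r.
Proof.
by rewrite /= in_itv/= => /andP[? ?]; rewrite ler_norml !ltW.
Qed.

Let rI2 q : `]-r, r[%classic q -> q ^+ 2 < 1.
Proof.
by rewrite /= in_itv/= => /andP[? ?]; have /andP[? ?] := r01; nra.
Qed.

Let domz q z : `]-r, r[%classic q ->
  let w := C * (expR (- (b * z.1 ^+ 2)) * expR (- (b * z.2 ^+ 2))) in
  [/\ bvn_pdf q z <= w, `|bvn_d1 q z * bvn_pdf q z| <= w &
      `|(bvn_d1 q z ^+ 2 + bvn_d2 q z) * bvn_pdf q z| <= w].
Proof. by move=> /rI qr; case: z => x y; exact: dom. Qed.

Lemma is_derive_pairing q : `]-r, r[%classic q ->
  is_derive q 1 pairing (pairing_d1 q).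
Proof.
move=> qr.
pose f (t : R) (z : R * R) : R := u z.1 * u z.2 * bvn_pdf t z.
have df t z : `]-r, r[%classic t ->
    is_derive t 1 (f ^~ z) (u z.1 * u z.2 * (bvn_d1 t z * bvn_pdf t z)).
  by move=> /rI2 t1; apply: is_derive1Ml; exact: is_derive_bvn_pdf.
have pE t z : `]-r, r[%classic t ->
    partial1of2 f t z = u z.1 * u z.2 * (bvn_d1 t z * bvn_pdf t z).
  by move=> tr; rewrite partial1of2E; have := df t z tr => -[_].
have If t : `]-r, r[%classic t -> lam2.-integrable setT (EFin \o f t).
  move=> tr; apply: integrable_uu; first exact: measurable_bvn_pdf.
  by move=> z; have [+ _ _] := domz z tr; rewrite ger0_norm// bvn_pdf_ge0.
have Df t z : `]-r, r[%classic t -> setT z -> derivable (f ^~ z) t 1.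
  by move=> tr _; have [] := df t z tr.
have Gub t z : `]-r, r[%classic t -> setT z -> `|partial1of2 f t z| <= G z.
  by move=> tr _; rewrite pE//; apply: le_G; have [] := domz z tr.
apply: DeriveDef.
  exact: (derivable_under_integral measurableT qr If Df G_ge0 iG Gub).
rewrite -derive1E.
rewrite (differentiation_under_integral measurableT qr If Df G_ge0 iG Gub).
by apply: eq_Rintegral => z _; rewrite pE.
Qed.

Lemma is_derive_pairing_d1 q : `]-r, r[%classic q ->
  is_derive q 1 pairing_d1 (pairing_d2 q).
Proof.
move=> qr.
pose f (t : R) (z : R * R) : R := u z.1 * u z.2 * (bvn_d1 t z * bvn_pdf t z).
have df t z : `]-r, r[%classic t -> is_derive t 1 (f ^~ z)
    (u z.1 * u z.2 * ((bvn_d1 t z ^+ 2 + bvn_d2 t z) * bvn_pdf t z)).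
  by move=> /rI2 t1; apply: is_derive1Ml; exact: is_derive_bvn_d1_pdf.
have pE t z : `]-r, r[%classic t -> partial1of2 f t z =
    u z.1 * u z.2 * ((bvn_d1 t z ^+ 2 + bvn_d2 t z) * bvn_pdf t z).
  by move=> tr; rewrite partial1of2E; have := df t z tr => -[_].
have If t : `]-r, r[%classic t -> lam2.-integrable setT (EFin \o f t).
  move=> tr; apply: integrable_uu.
    by apply: measurable_funM => //; exact: measurable_bvn_pdf.
  by move=> z; have [] := domz z tr.
have Df t z : `]-r, r[%classic t -> setT z -> derivable (f ^~ z) t 1.
  by move=> tr _; have [] := df t z tr.
have Gub t z : `]-r, r[%classic t -> setT z -> `|partial1of2 f t z| <= G z.
  by move=> tr _; rewrite pE//; apply: le_G; have [] := domz z tr.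
apply: DeriveDef.
  exact: (derivable_under_integral measurableT qr If Df G_ge0 iG Gub).
rewrite -derive1E.
rewrite (differentiation_under_integral measurableT qr If Df G_ge0 iG Gub).
by apply: eq_Rintegral => z _; rewrite pE.
Qed.

Let W : R := \int[lam]_x w1 x.

Lemma pairing_d2_le q : `]-r, r[%classic q -> `|pairing_d2 q| <= C * W ^+ 2.
Proof.
move=> qr.
have md2 : measurable_fun [set: R * R]
    (fun z => (bvn_d1 q z ^+ 2 + bvn_d2 q z) * bvn_pdf q z).
  apply: measurable_funM; last exact: measurable_bvn_pdf.
  have mdd : measurable_fun [set: R * R] (bvn_d2 q).
    have mQ (a : R) : measurable_fun [set: R * R]
        (fun z => z.1 ^+ 2 - a * q * z.1 * z.2 + z.2 ^+ 2).
      apply: measurable_funD; last exact: measurable_funX.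
      apply: measurable_funB; first exact: measurable_funX.
      by apply: measurable_funM => //; exact: measurable_funM.
    apply: measurable_funB.
      apply: measurable_funB; last by apply: measurable_funM.
      apply: measurable_funD => //; apply: measurable_funM => //.
      by apply: measurable_funM => //; exact: measurable_funM.
    by apply: measurable_funM => //; exact: measurable_funM.
  by apply: measurable_funD => //; exact: measurable_funX.
have iu : lam2.-integrable setT
    (EFin \o (fun z => u z.1 * u z.2 *
      ((bvn_d1 q z ^+ 2 + bvn_d2 q z) * bvn_pdf q z))).
  by apply: integrable_uu => // z; have [] := domz z qr.
apply: le_trans (le_normr_Rintegral measurableT iu) _.
apply: (@le_trans _ _ (\int[lam2]_z G z)).
  apply: le_Rintegral => //.
  - exact: (integrable_norm iu).
  - by move=> z _; apply: le_G; have [] := domz z qr.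
rewrite RintegralZl//; last exact: integrable_prod.
by rewrite Rintegral_prod// expr2.
Qed.

(** Second-order Taylor bound by two uses of the mean value theorem, giving up the factor [1/2]: the
    derivative vanishes at 0, hence is at most [C W^2 |t|] at [t]. The two signs are treated apart
    because the theorem takes ordered endpoints. *)
Lemma pairing_growth q : pairing_d1 0 = 0 -> `]-r, r[%classic q ->
  `|pairing q - pairing 0| <= C * W ^+ 2 * q ^+ 2.
Proof.
move=> d10 qr; have /andP[r0 _] := r01.
have B0 : 0 <= C * W ^+ 2 by rewrite mulr_ge0// sqr_ge0.
have seg x (a1 a2 : R) : `]-r, r[%classic a1 -> `]-r, r[%classic a2 ->
    x \in `[a1, a2] -> `]-r, r[%classic x.
  rewrite /= !in_itv/= => /andP[? ?] /andP[? ?] /andP[? ?]; lra.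
have r00 : `]-r, r[%classic (0 : R) by rewrite /= in_itv/=; lra.
have d1B t : `]-r, r[%classic t -> `|pairing_d1 t| <= C * W ^+ 2 * `|t|.
  move=> tr.
  have mvt a1 a2 : a1 <= a2 -> `]-r, r[%classic a1 -> `]-r, r[%classic a2 ->
      `|pairing_d1 a2 - pairing_d1 a1| <= C * W ^+ 2 * (a2 - a1).
    move=> a12 h1 h2.
    have [||x xa ->] := @MVT_segment _ pairing_d1 pairing_d2 a1 a2 a12.
    - move=> x /subset_itv_oo_cc xa; apply: is_derive_pairing_d1.
      exact: seg h1 h2 xa.
    - apply: derivable_within_continuous => x xa.
      by have [] := is_derive_pairing_d1 (seg _ _ _ h1 h2 xa).
    rewrite normrM (ger0_norm (x := a2 - a1)) ?subr_ge0// ler_wpM2r ?subr_ge0//.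
    exact: pairing_d2_le (seg _ _ _ h1 h2 xa).
  have [t0|t0] := leP 0 t.
    by have := mvt _ _ t0 r00 tr; rewrite d10 !subr0 (ger0_norm t0).
  have := mvt _ _ (ltW t0) tr r00; rewrite d10 sub0r normrN sub0r.
  by rewrite (ltr0_norm t0).
have mvt a1 a2 m : a1 <= a2 -> `]-r, r[%classic a1 -> `]-r, r[%classic a2 ->
    (forall x, x \in `[a1, a2] -> `|x| <= m) ->
    `|pairing a2 - pairing a1| <= C * W ^+ 2 * m * (a2 - a1).
  move=> a12 h1 h2 am.
  have [||x xa ->] := @MVT_segment _ pairing pairing_d1 a1 a2 a12.
  - move=> x /subset_itv_oo_cc xa; apply: is_derive_pairing.
    exact: seg h1 h2 xa.
  - apply: derivable_within_continuous => x xa.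
    by have [] := is_derive_pairing (seg _ _ _ h1 h2 xa).
  rewrite normrM (ger0_norm (x := a2 - a1)) ?subr_ge0// ler_wpM2r ?subr_ge0//.
  apply: le_trans (d1B _ (seg _ _ _ h1 h2 xa)) _.
  by rewrite ler_wpM2l// am.
have [q0|q0] := leP 0 q.
  have -> : C * W ^+ 2 * q ^+ 2 = C * W ^+ 2 * q * (q - 0) by ring.
  apply: mvt => //.
  by move=> x; rewrite in_itv/= => /andP[x0 xq]; rewrite ger0_norm.
rewrite distrC; have -> : C * W ^+ 2 * q ^+ 2 = C * W ^+ 2 * (- q) * (0 - q) by ring.
apply: (mvt _ _ _ (ltW q0)) => // x; rewrite in_itv/= => /andP[xq x0].
by rewrite ler0_norm// lerN2.
Qed.

End pair_integral.

(** * The pairing and its derivative at zero correlation *)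

Section pairing_at_0.
Context {R : realType}.
Notation lam := (@lebesgue_measure R).
Variable u : R -> R.
Hypothesis mu : measurable_fun [set: R] u.
Hypothesis u1 : forall x, `|u x| <= 1.
Notation phi0 := (normal_pdf (0 : R) 1).

Lemma normal_pdf01E (x : R) :
  phi0 x = normal_peak 1 * expR (- (2^-1 * x ^+ 2)).
Proof.
rewrite normal_pdfE//= /normal_fun subr0 expr1n; congr (_ * expR _).
by rewrite mulNr mulrC.
Qed.

Lemma normal_peak1_le1 : normal_peak 1 <= 1 :> R.
Proof.
rewrite /normal_peak expr1n mul1r.
have h : 1 <= pi *+ 2 :> R by rewrite mulr2n; have := @pi_ge2 R; lra.
rewrite invf_le1 ?sqrtr_gt0; last exact: lt_le_trans h.
by rewrite -[leLHS]sqrtr1 ler_wsqrtr.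
Qed.

Lemma normal_pdf01_le (x : R) : phi0 x <= expR (- (2^-1 * x ^+ 2)).
Proof. by rewrite normal_pdf01E ler_piMl ?expR_ge0// normal_peak1_le1. Qed.

(** Half of the rate [1/2] pays for the factor [|x|]: [|x| <= 1 + x^2 / 4 <= exp (x^2 / 4)]. *)
Lemma norm_mul_normal_pdf_le (x : R) :
  `|x * phi0 x| <= 1 * expR (- (4^-1 * x ^+ 2)).
Proof.
rewrite normrM (ger0_norm (normal_pdf_ge0 _ _ _)) normal_pdf01E.
have h : `|x| <= expR (4^-1 * x ^+ 2).
  apply: le_trans (expR_ge1Dx _).
  have -> : x ^+ 2 = `|x| ^+ 2 by rewrite real_normK ?num_real.
  by have := sqr_ge0 (`|x| - 2); nra.
have -> : - (4^-1 * x ^+ 2) = 4^-1 * x ^+ 2 + - (2^-1 * x ^+ 2) by field.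
rewrite expRD mul1r mulrA; apply: ler_wpM2r; first exact: expR_ge0.
rewrite -[leRHS]mulr1; apply: ler_pM => //; first exact: normal_peak_ge0.
exact: normal_peak1_le1.
Qed.

Lemma integrable_mul_normal_pdf :
  lam.-integrable setT (EFin \o (fun x => u x * (x * phi0 x))).
Proof.
apply: (@integrable_gaussian_dominated _ 4^-1 1) => //.
  apply: measurable_funM => //; apply: measurable_funM => //.
  exact: measurable_normal_pdf.
move=> x; rewrite normrM; apply: le_trans (norm_mul_normal_pdf_le x).
by rewrite ler_piMl.
Qed.

Lemma bvn_pdf0 x y : bvn_pdf 0 (x, y) = phi0 x * phi0 y.
Proof. by rewrite -bvn_pdfE ?expr0n//= mul0r subr0 sqrtr1. Qed.

(** At [q = 0] the logarithmic derivative is [x y] and the density is a product, so Fubini applies.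
    The integral being squared is the first Hermite coefficient of [u]. *)
Lemma pairing_d1_0 : pairing_d1 u 0 = (\int[lam]_x (u x * (x * phi0 x))) ^+ 2.
Proof.
rewrite expr2 -Rintegral_prod; [|exact: integrable_mul_normal_pdf..].
apply: eq_Rintegral => -[x y] _ /=; rewrite bvn_pdf0 /bvn_d1/=.
rewrite expr0n/= subr0 !mul0r invr1 mulr1 add0r subr0; ring.
Qed.

Lemma pairing0 : pairing u 0 = (\int[lam]_x (u x * phi0 x)) ^+ 2.
Proof.
have iu : lam.-integrable setT (EFin \o (fun x => u x * phi0 x)).
  apply: (@integrable_gaussian_dominated _ 2^-1 1) => //.
    by apply: measurable_funM => //; exact: measurable_normal_pdf.
  move=> x; rewrite normrM ler_pM// ger0_norm ?normal_pdf_ge0//.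
  exact: normal_pdf01_le.
rewrite expr2 -Rintegral_prod//.
by apply: eq_Rintegral => -[x y] _ /=; rewrite bvn_pdf0; ring.
Qed.

End pairing_at_0.

(** * Moments of bounded functions of a correlated pair *)

Lemma integrable_bounded d (T : measurableType d) (R : realType)
    (P : probability T R) (f : T -> R) (B : R) :
  measurable_fun setT f -> (forall x, `|f x| <= B) ->
  P.-integrable setT (EFin \o f).
Proof.
move=> mf fB; apply: (@le_integrable _ _ _ P _ measurableT _ (EFin \o cst B)) => //=.
- exact/measurable_EFinP.
- by move=> x _; rewrite lee_fin (le_trans (fB x))// ler_norm.
- exact: finite_measure_integrable_cst.
Qed.

Section bounded_transfer.
Context {R : realType}.
Notation lam := (@lebesgue_measure R).
Notation lam2 := (lam \x lam)%E.
Notation N := (normal_prob (0 : R) 1).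
Notation phi0 := (normal_pdf (0 : R) 1).

Lemma measurable_G2 q : measurable_fun [set: R * R] (@G2 R q).
Proof. by rewrite /G2; apply: measurable_funD; apply: measurable_funM. Qed.

Lemma integrable_bvn_pdf q : q ^+ 2 < 1 ->
  lam2.-integrable setT (EFin \o bvn_pdf q).
Proof.
move=> q1; apply/integrableP; split; first exact: measurable_EFin_bvn_pdf.
under eq_integral do rewrite /= ger0_norm ?bvn_pdf_ge0// -[X in X%:E]mul1r EFinM.
rewrite -(@ge0_integral_bvn _ q (cst 1%E))//=.
by rewrite integral_cst//= mul1e probability_setT ltry.
Qed.

(** The nonnegative case is applied to [f + B] and to the constant [B], and the results are
    subtracted. The same device gives [Rintegral_G2] and [Rintegral_normal_prob]. *)
Lemma Rintegral_bvn q (f : R * R -> R) (B : R) : q ^+ 2 < 1 ->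
  measurable_fun setT f -> (forall z, `|f z| <= B) ->
  \int[std_normal2]_z f (z.1, G2 q z) = \int[lam2]_z (f z * bvn_pdf q z).
Proof.
move=> q1 mf fB.
have mT : measurable_fun setT (fun z : R * R => (z.1, G2 q z)).
  by apply: measurable_fun_pair => //=; exact: measurable_G2.
have mfT : measurable_fun setT (fun z => f (z.1, G2 q z)) by exact: measurableT_comp.
have key (g : R * R -> R) : measurable_fun setT g -> (forall z, 0 <= g z) ->
    \int[std_normal2]_z g (z.1, G2 q z) = \int[lam2]_z (g z * bvn_pdf q z).
  move=> mg g0; congr fine.
  rewrite (@ge0_integral_bvn _ q (EFin \o g))//; exact/measurable_EFinP.
have ip := integrable_bvn_pdf q1.
have ifp : lam2.-integrable setT (EFin \o (fun z => f z * bvn_pdf q z)).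
  apply: (@le_integrable _ _ _ lam2 _ measurableT _
     (EFin \o (fun z => B * bvn_pdf q z))) => //=.
  - by apply/measurable_EFinP; apply: measurable_funM => //; exact: measurable_bvn_pdf.
  - move=> z _; rewrite lee_fin !normrM ler_wpM2r//.
    by rewrite (le_trans (fB z))// ler_norm.
  - have -> : EFin \o (fun z => B * bvn_pdf q z) =
        (fun z => B%:E * (EFin \o bvn_pdf q) z)%E.
      by apply/funext => z /=; rewrite EFinM.
    exact: integrableZl.
have iBp : lam2.-integrable setT (EFin \o (fun z => B * bvn_pdf q z)).
  have -> : EFin \o (fun z => B * bvn_pdf q z) =
      (fun z => B%:E * (EFin \o bvn_pdf q) z)%E.
    by apply/funext => z /=; rewrite EFinM.
  exact: integrableZl.
have B0 : 0 <= B by apply: le_trans (fB (0, 0)).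
have mfD : measurable_fun setT (fun z => f z + B) by exact: measurable_funD.
have fD0 z : 0 <= f z + B.
  by have := fB z; rewrite ler_norml => /andP[? _]; lra.
have H := key _ mfD fD0; have HB := key (cst B) (measurable_cst B) (fun=> B0).
rewrite /= in HB; move: H.
have i1 : std_normal2.-integrable setT (EFin \o (fun z => f (z.1, G2 q z))).
  by apply: (@integrable_bounded _ _ _ _ _ B) => // z; exact: fB.
have iB : std_normal2.-integrable setT (EFin \o (fun=> B)).
  exact: finite_measure_integrable_cst.
rewrite (RintegralD measurableT i1 iB).
rewrite HB.
under [X in _ = X -> _]eq_Rintegral do rewrite mulrDl.
rewrite (RintegralD measurableT ifp iBp).
exact: addIr.
Qed.

Lemma Rintegral_G2 q (f : R -> R) (B : R) : -1 <= q <= 1 ->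
  measurable_fun setT f -> (forall z, `|f z| <= B) ->
  \int[std_normal2]_z f (G2 q z) = \int[N]_x f x.
Proof.
move=> q1 mf fB.
have mfT : measurable_fun setT (fun z => f (G2 q z)).
  by apply: measurableT_comp => //; exact: measurable_G2.
have key (g : R -> R) : measurable_fun setT g -> (forall z, 0 <= g z) ->
    \int[std_normal2]_z g (G2 q z) = \int[N]_x g x.
  move=> mg g0; congr fine.
  rewrite (@ge0_integral_G2 _ q (EFin \o g))//; exact/measurable_EFinP.
have B0 : 0 <= B by apply: le_trans (fB 0).
have mfD : measurable_fun setT (fun z => f z + B) by exact: measurable_funD.
have fD0 z : 0 <= f z + B.
  by have := fB z; rewrite ler_norml => /andP[? _]; lra.
have H := key _ mfD fD0; have HB := key (cst B) (measurable_cst B) (fun=> B0).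
rewrite /= in HB; move: H.
have i1 : std_normal2.-integrable setT (EFin \o (fun z => f (G2 q z))).
  by apply: (@integrable_bounded _ _ _ _ _ B) => // z; exact: fB.
have iB : std_normal2.-integrable setT (EFin \o (fun=> B)).
  exact: finite_measure_integrable_cst.
rewrite (RintegralD measurableT i1 iB).
rewrite HB.
have j1 : N.-integrable setT (EFin \o f).
  by apply: (@integrable_bounded _ _ _ _ _ B).
have jB : N.-integrable setT (EFin \o (fun=> B)).
  exact: finite_measure_integrable_cst.
rewrite (RintegralD measurableT j1 jB).
exact: addIr.
Qed.

Lemma Rintegral_G1 (f : R -> R) (B : R) :
  measurable_fun setT f -> (forall z, `|f z| <= B) ->
  \int[std_normal2]_z f z.1 = \int[N]_x f x.
Proof.
move=> mf fB; rewrite -(@Rintegral_G2 1 f B)//; last by rewrite lexx lerNl; lra.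
by apply: eq_Rintegral => z _; rewrite /G2 mul1r expr1n subrr sqrtr0 mul0r addr0.
Qed.

Lemma Rintegral_normal_prob (f : R -> R) (B : R) :
  measurable_fun setT f -> (forall z, `|f z| <= B) ->
  \int[N]_x f x = \int[lam]_x (f x * phi0 x).
Proof.
move=> mf fB.
have ip : lam.-integrable setT (EFin \o phi0) := integrable_normal_pdf 0 1.
have iBp (b : R) : lam.-integrable setT (EFin \o (fun z => b * phi0 z)).
  have -> : EFin \o (fun z => b * phi0 z) = (fun z => b%:E * (EFin \o phi0) z)%E.
    by apply/funext => z /=; rewrite EFinM.
  exact: integrableZl.
have key (g : R -> R) : measurable_fun setT g -> (forall z, 0 <= g z) ->
    \int[N]_z g z = \int[lam]_z (g z * phi0 z).
  move=> mg g0; congr fine.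
  rewrite (@ge0_integral_normal_prob _ 0 1 (EFin \o g))//; exact/measurable_EFinP.
have ifp : lam.-integrable setT (EFin \o (fun z => f z * phi0 z)).
  apply: (@le_integrable _ _ _ lam _ measurableT _
     (EFin \o (fun z => B * phi0 z))) => //=.
  - by apply/measurable_EFinP; apply: measurable_funM => //; exact: measurable_normal_pdf.
  - move=> z _; rewrite lee_fin !normrM ler_wpM2r//.
    by rewrite (le_trans (fB z))// ler_norm.
have B0 : 0 <= B by apply: le_trans (fB 0).
have mfD : measurable_fun setT (fun z => f z + B) by exact: measurable_funD.
have fD0 z : 0 <= f z + B.
  by have := fB z; rewrite ler_norml => /andP[? _]; lra.
have H := key _ mfD fD0; have HB := key (cst B) (measurable_cst B) (fun=> B0).
rewrite /= in HB; move: H.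
have j1 : N.-integrable setT (EFin \o f).
  by apply: (@integrable_bounded _ _ _ _ _ B).
have jB : N.-integrable setT (EFin \o (fun=> B)).
  exact: finite_measure_integrable_cst.
rewrite (RintegralD measurableT j1 jB).
rewrite HB.
under [X in _ = X -> _]eq_Rintegral do rewrite mulrDl.
rewrite (RintegralD measurableT ifp (iBp B)).
exact: addIr.
Qed.

Section deviation.
Variable u : R -> R.
Hypothesis mu : measurable_fun [set: R] u.
Hypothesis u1 : forall x, `|u x| <= 1.

Let mu1 : measurable_fun [set: R * R] (fun z => u z.1).
Proof. exact: measurableT_comp. Qed.

Let mu2 q : measurable_fun [set: R * R] (fun z => u (G2 q z)).
Proof. by apply: measurableT_comp => //; exact: measurable_G2. Qed.

Let uu1 x y : `|u x * u y| <= 1.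
Proof. by rewrite normrM -[leRHS]mulr1 ler_pM. Qed.

(** The marginals do not depend on [q], so all dependence on [q] sits in the last term. *)
Lemma cross_moment1 q : -1 <= q <= 1 ->
  \int[std_normal2]_z ((1 + u z.1) * (1 + u (G2 q z))) =
  1 + 2 * \int[N]_x u x + \int[std_normal2]_z (u z.1 * u (G2 q z)).
Proof.
move=> q1.
have i1 : std_normal2.-integrable setT (EFin \o (fun z => u z.1)).
  by apply: (@integrable_bounded _ _ _ _ _ 1) => // z; exact: u1.
have i2 : std_normal2.-integrable setT (EFin \o (fun z => u (G2 q z))).
  by apply: (@integrable_bounded _ _ _ _ _ 1) => [|z]; [exact: mu2|exact: u1].
have i3 : std_normal2.-integrable setT (EFin \o (fun z => u z.1 * u (G2 q z))).
  apply: (@integrable_bounded _ _ _ _ _ 1) => [|z]; last exact: uu1.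
  by apply: measurable_funM; [exact: mu1|exact: mu2].
have ic : std_normal2.-integrable setT (EFin \o (fun=> 1 : R)).
  exact: finite_measure_integrable_cst.
have iD (f g : R * R -> R) : std_normal2.-integrable setT (EFin \o f) ->
    std_normal2.-integrable setT (EFin \o g) ->
    std_normal2.-integrable setT (EFin \o (fun z => f z + g z)).
  by move=> hf hg; exact: (integrableD measurableT hf hg).
transitivity (\int[std_normal2]_z
    (1 + u z.1 + u (G2 q z) + u z.1 * u (G2 q z))).
  by apply: eq_Rintegral => z _; ring.
rewrite (RintegralD measurableT (iD _ _ (iD _ _ ic i1) i2) i3).
rewrite (RintegralD measurableT (iD _ _ ic i1) i2) (RintegralD measurableT ic i1).
rewrite (Rintegral_G1 mu u1) (Rintegral_G2 q1 mu u1).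
rewrite Rintegral_cst//= [X in fine X](_ : _ = 1%E); last exact: probability_setT.
by rewrite /= mulr1; ring.
Qed.

(** From [|a b| <= (a^2 + b^2) / 2] and the equality of the marginals; it reaches [|q| = 1], where
    the density representation fails. *)
Lemma cross_moment_le q : -1 <= q <= 1 ->
  `|\int[std_normal2]_z (u z.1 * u (G2 q z))| <= \int[N]_x (u x ^+ 2).
Proof.
move=> q1.
have i3 : std_normal2.-integrable setT (EFin \o (fun z => u z.1 * u (G2 q z))).
  apply: (@integrable_bounded _ _ _ _ _ 1) => [|z]; last exact: uu1.
  by apply: measurable_funM; [exact: mu1|exact: mu2].
have mu2' : measurable_fun [set: R] (fun x => u x ^+ 2) by exact: measurable_funX.
have u21 x : `|u x ^+ 2| <= 1 by rewrite expr2 uu1.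
have j1 : std_normal2.-integrable setT (EFin \o (fun z => 2^-1 * u z.1 ^+ 2)).
  apply: (@integrable_bounded _ _ _ _ _ 1).
    by apply: measurable_funM => //; exact: measurable_funX.
  by move=> z; rewrite normrM ger0_norm//; have := u21 z.1; lra.
have j2 : std_normal2.-integrable setT (EFin \o (fun z => 2^-1 * u (G2 q z) ^+ 2)).
  apply: (@integrable_bounded _ _ _ _ _ 1).
    by apply: measurable_funM => //; apply: measurable_funX; exact: mu2.
  by move=> z; rewrite normrM ger0_norm//; have := u21 (G2 q z); lra.
have k1 : std_normal2.-integrable setT (EFin \o (fun z => u z.1 ^+ 2)).
  by apply: (@integrable_bounded _ _ _ _ _ 1) => [|z]; [exact: measurable_funX|exact: u21].
have k2 : std_normal2.-integrable setT (EFin \o (fun z => u (G2 q z) ^+ 2)).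
  by apply: (@integrable_bounded _ _ _ _ _ 1) => [|z]; [apply: measurable_funX; exact: mu2|exact: u21].
apply: le_trans (le_normr_Rintegral measurableT i3) _.
apply: (@le_trans _ _ (\int[std_normal2]_z
    (2^-1 * u z.1 ^+ 2 + 2^-1 * u (G2 q z) ^+ 2))).
  apply: le_Rintegral => //.
  - exact: (integrable_norm i3).
  - exact: (integrableD measurableT j1 j2).
  - move=> z _; have am_gm (a c : R) : `|a * c| <= 2^-1 * a ^+ 2 + 2^-1 * c ^+ 2.
      have h1 := sqr_ge0 (a - c); have h2 := sqr_ge0 (a + c).
      by rewrite ler_norml; apply/andP; split; nra.
    exact: am_gm.
rewrite (RintegralD measurableT j1 j2).
rewrite (RintegralZl _ measurableT k1) (RintegralZl _ measurableT k2).
rewrite (Rintegral_G1 mu2' u21) (Rintegral_G2 q1 mu2' u21).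
lra.
Qed.

Lemma cross_moment_pairing q : q ^+ 2 < 1 ->
  \int[std_normal2]_z (u z.1 * u (G2 q z)) = pairing u q.
Proof.
move=> q1; rewrite (@Rintegral_bvn q (fun z => u z.1 * u z.2) 1)//.
by apply: measurable_funM; exact: measurableT_comp.
Qed.

End deviation.

End bounded_transfer.

(** * Gaussian tails and the tilting parameter *)

Section gaussian_tails.
Context {R : realType}.
Notation lam := (@lebesgue_measure R).
Notation N := (normal_prob (0 : R) 1).
Notation phi0 := (normal_pdf (0 : R) 1).
Implicit Types (k c h : R).

Lemma integral_isometry m s (f : R -> \bar R) : `|s| = 1 ->
  measurable_fun setT f ->
  (\int[lam]_x f x = \int[lam]_y f (m + s * y)%R)%E.
Proof.
move=> s1 mf; have s0 : s != 0 by rewrite -normr_eq0 s1 oner_eq0.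
rewrite [LHS]integralE [RHS]integralE.
rewrite (ge0_integral_affine m s0)//; last exact: measurable_funepos.
rewrite (ge0_integral_affine m s0 (measurable_funeneg mf))// s1 !mul1e.
by congr (_ - _)%E; apply: eq_integral => x _; rewrite !(funeposE, funenegE).
Qed.

Lemma Rintegral_isometry m s (f : R -> R) : `|s| = 1 ->
  measurable_fun setT f ->
  \int[lam]_x f x = \int[lam]_y f (m + s * y).
Proof.
by move=> s1 mf; congr fine; rewrite (integral_isometry m s1)//; exact/measurable_EFinP.
Qed.

Lemma normal_pdf01N x : phi0 (- x) = phi0 x.
Proof. by rewrite !normal_pdf01E sqrrN. Qed.

Lemma normal_pdf01_gt0 x : 0 < phi0 x.
Proof. by rewrite normal_pdf01E mulr_gt0 ?expR_gt0 ?normal_peak_gt0. Qed.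

Lemma norm_bool_le1 (b : bool) : `|b%:R| <= 1 :> R.
Proof. by case: b; rewrite ?normr1 ?normr0. Qed.

Lemma measurable_ge h : measurable_fun [set: R] (fun x => (h <= x)%R%:R : R).
Proof.
have -> : (fun x => (h <= x)%R%:R) = \1_`[h, +oo[ :> (R -> R).
  by apply/funext => x; rewrite indicE mem_setE in_itv/= andbT.
exact: measurable_indic.
Qed.

Lemma measurable_lt h : measurable_fun [set: R] (fun x => (x < h)%R%:R : R).
Proof.
have -> : (fun x => (x < h)%R%:R) = \1_`]-oo, h[ :> (R -> R).
  by apply/funext => x; rewrite indicE mem_setE in_itv/=.
exact: measurable_indic.
Qed.

Lemma Rintegral_ge h (f : R -> R) :
  \int[lam]_(x in `[h, +oo[) f x = \int[lam]_x ((h <= x)%R%:R * f x).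
Proof.
rewrite Rintegral_mkcond; apply: eq_Rintegral => x _.
by rewrite patch_indic/= indicE mem_setE in_itv/= andbT mulrC.
Qed.

Lemma Rintegral_lt h (f : R -> R) :
  \int[lam]_(x in `]-oo, h[) f x = \int[lam]_x ((x < h)%R%:R * f x).
Proof.
rewrite Rintegral_mkcond; apply: eq_Rintegral => x _.
by rewrite patch_indic/= indicE mem_setE in_itv/= mulrC.
Qed.

Lemma integrable_phi0 : lam.-integrable setT (EFin \o phi0).
Proof. exact: integrable_normal_pdf. Qed.

Lemma integrable_bounded_phi0 (f : R -> R) B : measurable_fun setT f ->
  (forall x, `|f x| <= B) -> lam.-integrable setT (EFin \o (fun x => f x * phi0 x)).
Proof.
move=> mf fB; apply: (@integrable_gaussian_dominated _ 2^-1 B) => //.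
  by apply: measurable_funM => //; exact: measurable_normal_pdf.
move=> x; rewrite normrM; apply: ler_pM => //.
by rewrite ger0_norm ?normal_pdf_ge0// normal_pdf01_le.
Qed.

Lemma integrable_bounded_mul_phi0 (f : R -> R) B : measurable_fun setT f ->
  (forall x, `|f x| <= B) ->
  lam.-integrable setT (EFin \o (fun x => f x * (x * phi0 x))).
Proof.
move=> mf fB; apply: (@integrable_gaussian_dominated _ 4^-1 B) => //.
  apply: measurable_funM => //; apply: measurable_funM => //.
  exact: measurable_normal_pdf.
move=> x; rewrite normrM; apply: ler_pM => //.
by rewrite -[leRHS]mul1r norm_mul_normal_pdf_le.
Qed.

Lemma Rintegral_phi0 : \int[lam]_x phi0 x = 1.
Proof. by rewrite /Rintegral integral_normal_pdf. Qed.

Lemma Phi_lt h : Phi h = \int[lam]_x ((x < h)%R%:R * phi0 x).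
Proof.
rewrite /Phi /normal_prob -Rintegral_lt Rintegral_itv_bndo_bndc//.
by apply: integrableS integrable_phi0.
Qed.

Lemma one_sub_Phi h : 1 - Phi h = \int[lam]_x ((h <= x)%R%:R * phi0 x).
Proof.
rewrite Phi_lt -[X in X - _ = _]Rintegral_phi0 -RintegralB//; last 2 first.
- exact: integrable_phi0.
- exact: integrable_bounded_phi0 (measurable_lt h) (fun x => norm_bool_le1 _).
apply: eq_Rintegral => x _; rewrite -[X in X - _]mul1r -mulrBl; congr (_ * _).
by rewrite leNgt; case: (x < h); rewrite /= ?subrr ?subr0.
Qed.

Lemma is_derive_normal_pdf01 (x : R) : is_derive x 1 phi0 (- (x * phi0 x)).
Proof.
have -> : phi0 = (fun x => normal_peak 1 * expR (- (2^-1 * x ^+ 2))).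
  by apply/funext => t; exact: normal_pdf01E.
have H := is_derive1Ml (normal_peak 1) (is_derive1_comp_expR
  (is_derive1N (is_derive1Ml 2^-1 (is_derive1_sqr x)))).
by apply: (is_derive_eq H); field.
Qed.

Lemma cvg_normal_pdf01 : phi0 x @[x --> +oo%R] --> (0 : R).
Proof.
have -> : phi0 = (fun x => normal_peak 1 * expR (- (2^-1 * x ^+ 2))).
  by apply/funext => t; exact: normal_pdf01E.
rewrite -[X in _ --> X](mulr0 (normal_peak 1)); apply: cvgM; first exact: cvg_cst.
under eq_fun do rewrite [2^-1 * _]mulrC.
apply: (cvg_comp (fun x => x ^+ 2 * 2^-1) (fun x => expR (- x))).
  by apply: gt0_cvgMly; [rewrite invr_gt0|exact: cvgr_expr2].
exact: cvgr_expR.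
Qed.

(** [- phi0] is an antiderivative of [x * phi0 x]; the sign of [h] keeps the integrand nonnegative,
    as the half-line form of the fundamental theorem applied here requires. *)
Lemma first_moment_ge0 h : 0 <= h ->
  \int[lam]_x ((h <= x)%R%:R * (x * phi0 x)) = phi0 h.
Proof.
move=> h0; rewrite -Rintegral_ge.
rewrite (@Rintegral_ge0_continuous_FTC2y _ _ (fun x => - phi0 x) h 0).
- by rewrite sub0r opprK.
- by move=> x hx; rewrite mulr_ge0 ?normal_pdf_ge0// (le_trans h0).
- apply: continuous_subspaceT => x; apply: cvgM; first exact: cvg_id.
  by apply: continuous_normal_pdf.
- by rewrite -[X in _ --> X]oppr0; apply: cvgN; exact: cvg_normal_pdf01.
- by move=> x _; have [] := is_derive1N (is_derive_normal_pdf01 x).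
- apply: cvg_at_right_filter; apply: cvgN; exact: continuous_normal_pdf.
- move=> x _; rewrite derive1E.
  by have [_ ->] := is_derive1N (is_derive_normal_pdf01 x); rewrite opprK.
Qed.

Let mmul : measurable_fun [set: R] (fun x => x * phi0 x).
Proof. by apply: measurable_funM => //; exact: measurable_normal_pdf. Qed.

Lemma Rintegral_mul_phi0 : \int[lam]_x (x * phi0 x) = 0.
Proof.
set I := LHS; suff : I = - I by lra.
rewrite {1}/I (@Rintegral_isometry 0 (-1)) ?normrN1//.
rewrite -[- I]mulN1r /I -RintegralZl//.
  by apply: eq_Rintegral => x _; rewrite add0r mulN1r normal_pdf01N; ring.
have := @integrable_bounded_mul_phi0 (fun=> 1) 1 (measurable_cst _) (fun=> norm_bool_le1 true).
by congr (_.-integrable _ _); apply/funext => x; rewrite /= mul1r.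
Qed.

(** For [h < 0], the total first moment vanishes by oddness, and reflecting the part below [h]
    reduces to the level [- h]. *)
Lemma first_moment h : \int[lam]_x ((h <= x)%R%:R * (x * phi0 x)) = phi0 h.
Proof.
have [h0|h0] := leP 0 h; first exact: first_moment_ge0.
have ilt := integrable_bounded_mul_phi0 (measurable_lt h) (fun x => norm_bool_le1 _).
have ige := integrable_bounded_mul_phi0 (measurable_ge h) (fun x => norm_bool_le1 _).
have split : \int[lam]_x ((h <= x)%R%:R * (x * phi0 x)) +
    \int[lam]_x ((x < h)%R%:R * (x * phi0 x)) = 0.
  rewrite -RintegralD// -[RHS]Rintegral_mul_phi0; apply: eq_Rintegral => x _.
  by rewrite -mulrDl leNgt; case: (x < h); rewrite /= ?add0r ?addr0 mul1r.
suff : \int[lam]_x ((x < h)%R%:R * (x * phi0 x)) = - phi0 h by lra.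
have h0' : 0 <= - h by lra.
rewrite -(normal_pdf01N h) -(first_moment_ge0 h0').
rewrite (@Rintegral_isometry 0 (-1)) ?normrN1//; last first.
  by apply: measurable_funM => //; exact: measurable_lt.
rewrite -[in RHS]mulN1r -RintegralZl//; last first.
  exact: integrable_bounded_mul_phi0 (measurable_ge (- h)) (fun x => norm_bool_le1 _).
have ibnd (f : R -> R) : measurable_fun setT f -> (forall x, `|f x| <= 1) ->
    lam.-integrable setT (EFin \o (fun x => f x * (x * phi0 x))).
  exact: integrable_bounded_mul_phi0.
transitivity (\int[lam]_(x in `]- h, +oo[) (- (x * phi0 x))).
  rewrite [RHS]Rintegral_mkcond; apply: eq_Rintegral => x _.
  rewrite patch_indic/= indicE mem_setE in_itv/= andbT add0r mulN1r normal_pdf01N.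
  by rewrite ltrNl; ring.
rewrite Rintegral_itv_obnd_cbnd//; last first.
  have -> : EFin \o (fun x => - (x * phi0 x)) = EFin \o (fun x => -1 * (x * phi0 x)).
    by apply/funext => x /=; rewrite mulN1r.
  apply: integrableS (ibnd (cst (-1)) _ _) => //.
  by move=> x; rewrite /= normrN1.
rewrite Rintegral_ge; apply: eq_Rintegral => x _; ring.
Qed.

(** The function [f] of the overview with the parameter [c] left free, since [c_star] is located by
    comparing different values of [c]. *)
Definition tilt k c x : R := (k <= x)%R%:R * expR (- (c * x)).

Lemma measurable_tilt k c : measurable_fun [set: R] (tilt k c).
Proof.
apply: measurable_funM; first exact: measurable_ge.
by apply: measurableT_comp => //; apply: measurableT_comp => //; exact: measurable_funM.
Qed.

Lemma tilt_ge0 k c x : 0 <= tilt k c x.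
Proof. by rewrite mulr_ge0 ?expR_ge0. Qed.

Lemma tilt_le k c x : 0 <= c -> tilt k c x <= expR (- (c * k)).
Proof.
move=> c0; rewrite /tilt; case: (leP k x) => kx /=; last by rewrite mul0r expR_ge0.
by rewrite mul1r ler_expR lerN2 ler_wpM2l.
Qed.

Lemma norm_tilt_le k c x : 0 <= c -> `|tilt k c x| <= expR (- (c * k)).
Proof. by move=> c0; rewrite ger0_norm ?tilt_ge0//; exact: tilt_le. Qed.

(* Completing the square turns the tilted integral into a tail integral; it
   vanishes exactly at the solutions of the equation defining [c_star]. *)
Lemma tilted_first_moment k c : 0 <= c ->
  \int[lam]_x (tilt k c x * (x * phi0 x)) =
  expR (c ^+ 2 / 2) * (phi0 (k + c) - c * (1 - Phi (k + c))).
Proof.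
move=> c0.
rewrite (@Rintegral_isometry (- c) 1) ?normr1//; last first.
  by apply: measurable_funM => //; exact: measurable_tilt.
have i1 := integrable_bounded_mul_phi0 (measurable_ge (k + c)) (fun x => norm_bool_le1 _).
have i2 := integrable_bounded_phi0 (measurable_ge (k + c)) (fun x => norm_bool_le1 _).
have i3 : lam.-integrable setT
    (EFin \o (fun x => c * ((k + c <= x)%R%:R * phi0 x))).
  have -> : EFin \o (fun x => c * ((k + c <= x)%R%:R * phi0 x)) =
     (fun x => c%:E * (EFin \o (fun x => ((k + c <= x)%R%:R * phi0 x)%R)) x)%E.
    by apply/funext => x /=; rewrite EFinM.
  exact: integrableZl.
rewrite one_sub_Phi -first_moment -RintegralZl// -RintegralB// -RintegralZl//; last first.
  exact: (integrableB measurableT i1 i3).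
apply: eq_Rintegral => x _; rewrite /tilt mul1r.
have -> : (k <= - c + x) = (k + c <= x) by rewrite addrC lerBrDr.
case: leP => _ /=; rewrite ?mul0r ?mulr0 ?mul1r ?subr0 ?mulr0//.
rewrite !normal_pdf01E.
have -> : expR (- (2^-1 * (- c + x) ^+ 2)) =
  expR (- (2^-1 * x ^+ 2)) * expR (c ^+ 2 / 2) * expR (c * (- c + x)).
  by rewrite -!expRD; congr expR; field.
rewrite [expR (- (c * _))]expRN.
by field; rewrite gt_eqF// expR_gt0.
Qed.

(** Pointwise, [x exp (- c x)] is nonincreasing in [c] for either sign of [x]. This monotonicity is
    what confines the roots of the equation for [c_star]. *)
Lemma tilted_first_moment_decr k c1 c2 : 0 <= c1 -> c1 <= c2 ->
  \int[lam]_x (tilt k c2 x * (x * phi0 x)) <=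
  \int[lam]_x (tilt k c1 x * (x * phi0 x)).
Proof.
move=> c10 c12; have c20 := le_trans c10 c12.
apply: le_Rintegral => //.
- by apply: (integrable_bounded_mul_phi0 (measurable_tilt k c2)) => x; exact: norm_tilt_le.
- by apply: (integrable_bounded_mul_phi0 (measurable_tilt k c1)) => x; exact: norm_tilt_le.
move=> x _; rewrite !mulrA; apply: ler_wpM2r; first exact: normal_pdf_ge0.
rewrite /tilt -!mulrA ler_wpM2l//.
have [x0|x0] := leP 0 x.
  by rewrite ler_wpM2r// ler_expR lerN2 ler_wpM2r.
by rewrite ler_wnM2r ?(ltW x0)// ler_expR lerN2 ler_wnM2r// ltW.
Qed.

Lemma Phi_sub h1 h2 : h1 <= h2 ->
  Phi h2 - Phi h1 = \int[lam]_(x in `]h1, h2]) phi0 x.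
Proof.
move=> h12; rewrite /Phi /normal_prob.
rewrite -[_ - fine _]/(Rintegral lam `]-oo, h2] phi0 - Rintegral lam `]-oo, h1] phi0).
by rewrite Rintegral_itvB//; apply: integrableS integrable_phi0.
Qed.

Lemma integrable_cst_itv h1 h2 (r : R) :
  lam.-integrable `]h1, h2] (EFin \o (fun=> r)).
Proof.
apply/integrableP; split; first exact/measurable_EFinP/measurable_cst.
rewrite /= integral_cst//= lebesgue_measure_itv/=.
by case: ifP => _; rewrite ?mule0 ?ltry// -EFinB -EFinM ltry.
Qed.

Lemma Rintegral_cst_itv h1 h2 (r : R) : h1 <= h2 ->
  \int[lam]_(x in `]h1, h2]) r = r * (h2 - h1).
Proof.
move=> h12; have E : fine (lam `]h1, h2]) = h2 - h1.
  rewrite lebesgue_measure_itv/= lte_fin; case: ltP => //= h21.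
  by apply/esym/eqP; rewrite subr_eq0 eq_le h12 h21.
by rewrite Rintegral_cst//; congr (_ * _); exact: E.
Qed.

Lemma Phi_lipschitz h1 h2 : h1 <= h2 -> 0 <= Phi h2 - Phi h1 <= h2 - h1.
Proof.
move=> h12; rewrite Phi_sub//; apply/andP; split.
  by apply: Rintegral_ge0 => x _; exact: normal_pdf_ge0.
rewrite -[leRHS]mul1r -Rintegral_cst_itv//; apply: le_Rintegral => //.
- by apply: integrableS integrable_phi0.
- exact: integrable_cst_itv.
- move=> x _; apply: (le_trans (@normal_pdf_ub R 0 1 x (oner_neq0 R))).
  exact: normal_peak1_le1.
Qed.

(** The density increases on the negative half-line, so the unit interval ending at [h] has mass at
    least [phi0 (h - 1)]. The loss against the true tail is only exponential in [|h|], harmless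
    against a change of Gaussian rate. *)
Lemma Phi_ge h : h <= 0 -> phi0 (h - 1) <= Phi h.
Proof.
move=> h0; have hh : h - 1 <= h by lra.
have Phi0 : 0 <= Phi (h - 1) by rewrite fine_ge0.
suff : phi0 (h - 1) <= Phi h - Phi (h - 1) by lra.
rewrite Phi_sub//.
have -> : phi0 (h - 1) = \int[lam]_(x in `]h - 1, h]) phi0 (h - 1).
  by rewrite Rintegral_cst_itv//; ring.
apply: le_Rintegral => //.
- exact: integrable_cst_itv.
- by apply: integrableS integrable_phi0.
move=> x; rewrite /= in_itv/= => /andP[x1 x2]; rewrite !normal_pdf01E.
by apply: ler_wpM2l; [exact: normal_peak_ge0|rewrite ler_expR; nra].
Qed.

Lemma continuous_Phi : continuous (@Phi R).
Proof.
move=> x; apply/cvgrPdist_le => e e0; near=> y.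
have : `|x - y| <= e by near: y; exact: cvgr_dist_le.
have [xy|yx] := leP x y.
  have /andP[? ?] := Phi_lipschitz xy.
  by rewrite ler0_norm ?subr_le0// => h; rewrite ler0_norm; lra.
have /andP[? ?] := Phi_lipschitz (ltW yx).
by rewrite gtr0_norm ?subr_gt0// => h; rewrite ger0_norm; lra.
Unshelve. all: by end_near. Qed.

(** The intermediate value theorem provides a root, and monotonicity of the tilted first moment puts
    whichever root [xget] returns below [c1]: at [c1] that moment is already negative. *)
Lemma c_star_spec k c1 : 0 < c1 -> phi0 (k + c1) < c1 * (1 - Phi (k + c1)) ->
  [/\ 0 < c_star k, c_star k < c1 &
      \int[lam]_x (tilt k (c_star k) x * (x * phi0 x)) = 0].
Proof.
move=> c10 H1.
have : exists c, 0 < c /\ c * (1 - Phi (k + c)) = phi (k + c).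
  pose D c := c * (1 - Phi (k + c)) - phi0 (k + c).
  have cD : continuous D.
    move=> c; apply: cvgB.
      apply: cvgM; first exact: cvg_id.
      apply: cvgB; first exact: cvg_cst.
      apply: continuous_comp; last exact: continuous_Phi.
      by apply: cvgD; [exact: cvg_cst|exact: cvg_id].
    apply: continuous_comp; last by apply: continuous_normal_pdf.
    by apply: cvgD; [exact: cvg_cst|exact: cvg_id].
  have D0 : D 0 < 0 by rewrite /D mul0r sub0r addr0 oppr_lt0 normal_pdf01_gt0.
  have D1 : 0 < D c1 by rewrite /D subr_gt0.
  have [||c c01 Dc] := @IVT _ D 0 c1 0 (ltW c10).
  - exact: continuous_subspaceT.
  - by rewrite ge_min le_max (ltW D0) (ltW D1) orbT.
  exists c; split; last by apply/eqP; rewrite -subr_eq0 -/(D c) Dc.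
  rewrite lt_neqAle; move: c01; rewrite in_itv/= => /andP[-> _]; rewrite andbT.
  by apply/eqP => c0; move: Dc D0; rewrite -c0 => ->; rewrite ltxx.
move=> /(xgetPex 0) [c0 cE]; rewrite -/(c_star k) in c0 cE.
have M0 : \int[lam]_x (tilt k (c_star k) x * (x * phi0 x)) = 0.
  by rewrite tilted_first_moment ?ltW// cE subrr mulr0.
split => //; rewrite ltNge; apply/negP => c1c.
have := tilted_first_moment_decr k (ltW c10) c1c.
rewrite M0 (tilted_first_moment k (ltW c10)) leNgt pmulr_rlt0 ?expR_gt0//.
by rewrite subr_lt0 H1.
Qed.

End gaussian_tails.

(** * Size of the deviation *)

Section deviation_bounds.
Context {R : realType}.
Notation lam := (@lebesgue_measure R).
Notation N := (normal_prob (0 : R) 1).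
Notation phi0 := (normal_pdf (0 : R) 1).
Implicit Types (k c b : R).

Definition dev k c x : R := tilt k c x - 1.

Lemma measurable_dev k c : measurable_fun [set: R] (dev k c).
Proof. by apply: measurable_funB => //; exact: measurable_tilt. Qed.

Lemma integrableZ (f : R -> R) (a : R) : lam.-integrable setT (EFin \o f) ->
  lam.-integrable setT (EFin \o (fun x => a * f x)).
Proof.
move=> ifx; have -> : EFin \o (fun x => a * f x) = (fun x => a%:E * (EFin \o f) x)%E.
  by apply/funext => x /=; rewrite EFinM.
exact: integrableZl.
Qed.

Lemma integrable_sqr_gaussian b : 0 < b ->
  lam.-integrable setT (EFin \o (fun x => x ^+ 2 * expR (- (b * x ^+ 2)))).
Proof.
move=> b0; apply: (@integrable_gaussian_dominated _ (b / 2) (2 / b)).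
- by rewrite divr_gt0.
- by apply: measurable_funM; [exact: measurable_funX|exact: measurable_gaussian].
move=> x; rewrite ger0_norm; last by apply: mulr_ge0; rewrite ?sqr_ge0 ?expR_ge0.
have -> : - (b * x ^+ 2) = - (b / 2 * x ^+ 2) - b / 2 * x ^+ 2 by field.
rewrite expRD mulrCA mulrC; apply: ler_wpM2r; first exact: expR_ge0.
rewrite expRN ler_pdivrMr ?expR_gt0//.
have b2 : 0 <= 2 / b by rewrite divr_ge0// ltW.
apply: (le_trans _ (ler_wpM2l b2 (expR_ge1Dx (b / 2 * x ^+ 2)))).
have -> : 2 / b * (1 + b / 2 * x ^+ 2) = 2 / b + x ^+ 2 by field; rewrite gt_eqF.
by rewrite lerDr.
Qed.

Lemma integrable_norm_gaussian b : 0 < b ->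
  lam.-integrable setT (EFin \o (fun x => `|x| * expR (- (b * x ^+ 2)))).
Proof.
move=> b0; apply: (@le_integrable _ _ _ lam _ measurableT _ (EFin \o (fun x =>
  1 * expR (- (b * x ^+ 2)) + x ^+ 2 * expR (- (b * x ^+ 2))))).
- apply/measurable_EFinP; apply: measurable_funM => //.
  exact: measurable_gaussian.
- move=> x _; rewrite lee_fin -mulrDl !normrM ler_wpM2r// normr_id.
  rewrite ger0_norm ?addr_ge0 ?sqr_ge0//.
  have -> : x ^+ 2 = `|x| ^+ 2 by rewrite real_normK ?num_real.
  by have := sqr_ge0 (`|x| - 1); nra.
- exact: (integrableD measurableT (integrableZ 1 (integrable_gaussian b0))
    (integrable_sqr_gaussian b0)).
Qed.

Section fixed_c.
Variables k c : R.
Hypothesis c0 : 0 <= c.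
Hypothesis ck : - (c * k) <= ln 2.

(** On its support the tilt is largest at [x = k], where [ck] bounds it by 2. *)
Lemma dev_le1 x : `|dev k c x| <= 1.
Proof.
have h : tilt k c x <= 2.
  apply: le_trans (tilt_le _ _ c0) _.
  by rewrite -[leRHS]lnK ?posrE// ler_expR.
by rewrite ler_norml /dev; have := tilt_ge0 k c x; lra.
Qed.

(** Below [k] the deviation is [-1]. Above, [1 - exp (- y) <= y] settles [x >= 0]; for [k <= x < 0],
    [(1 + c x) exp (- c x) <= 1] gives [exp (- c x) - 1 <= c |x| exp (- c x)], and the last
    exponential is at most 2 by [ck]. *)
Lemma dev_le x : `|dev k c x| <= (x < k)%R%:R + 2 * c * `|x|.
Proof.
have cx0 : 0 <= 2 * c * `|x| by rewrite !mulr_ge0.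
rewrite /dev /tilt; have [xk|kx] := ltP x k.
  by rewrite /= mul0r sub0r normrN1 lerDl.
rewrite /= mul1r add0r.
have [x0|x0] := leP 0 x.
  have h1 : expR (- (c * x)) <= 1 by rewrite -expR0 ler_expR oppr_le0 mulr_ge0.
  have h2 := expR_ge1Dx (- (c * x)).
  by rewrite ler0_norm ?subr_le0//; rewrite (ger0_norm x0) in cx0 *; lra.
have cxn : c * x <= 0 by rewrite mulr_ge0_le0// ltW.
have h1 : 1 <= expR (- (c * x)) by rewrite -[leLHS]expR0 ler_expR oppr_ge0.
rewrite ger0_norm ?subr_ge0// ltr0_norm//.
have h2 : expR (- (c * x)) <= 2.
  rewrite -[leRHS]lnK ?posrE// ler_expR; apply: le_trans ck.
  by rewrite lerN2 ler_wpM2l.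
have h3 := expR_ge1Dx (c * x).
have h4 : (1 + c * x) * expR (- (c * x)) <= 1.
  apply: le_trans (ler_wpM2r (expR_ge0 _) h3) _.
  by rewrite expRxMexpNx_1.
move: h1 h2 h4; set E := expR _; move: cxn; set y := c * x => y0 h1 h2 h4.
have -> : 2 * c * - x = - (2 * y) by rewrite /y; ring.
nra.
Qed.

(** Squaring the sum in [dev_le] blindly would produce a cross term. The indicator keeps coefficient
    1 because [dev] is [-1] below [k], while above [k] the linear term stands alone; the sharp
    constant of the lower bound rests on this. *)
Lemma dev_sqr_le x : dev k c x ^+ 2 <= (x < k)%R%:R + 4 * c ^+ 2 * x ^+ 2.
Proof.
have h := dev_le x.
have -> : dev k c x ^+ 2 = `|dev k c x| ^+ 2 by rewrite real_normK ?num_real.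
move: h; rewrite /dev /tilt; have [xk|kx] := ltP x k => /= h.
  rewrite mul0r sub0r normrN1 expr1n lerDl mulr_ge0 ?sqr_ge0//.
  by rewrite mulr_ge0 ?sqr_ge0.
have -> : 0 + 4 * c ^+ 2 * x ^+ 2 = (0 + 2 * c * `|x|) ^+ 2.
  by rewrite !add0r !exprMn real_normK ?num_real//; ring.
by rewrite lerXn2r// nnegrE// add0r !mulr_ge0.
Qed.

Lemma integrable_lt_phi0 :
  lam.-integrable setT (EFin \o (fun x => (x < k)%R%:R * phi0 x)).
Proof.
apply: (integrable_bounded_phi0 (B := 1) (measurable_lt k)) => x.
exact: norm_bool_le1.
Qed.

Lemma dev_second_moment :
  \int[N]_x (dev k c x ^+ 2) <=
  Phi k + 4 * c ^+ 2 * \int[lam]_x (x ^+ 2 * expR (- (2^-1 * x ^+ 2))).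
Proof.
have md : measurable_fun setT (fun x => dev k c x ^+ 2).
  by apply: measurable_funX; exact: measurable_dev.
have d1 x : `|dev k c x ^+ 2| <= 1.
  by rewrite normrX exprn_ile1// dev_le1.
rewrite (Rintegral_normal_prob md d1) Phi_lt -RintegralZl//; last first.
  exact: integrable_sqr_gaussian.
have i1 := integrable_lt_phi0.
have i2 := integrableZ (4 * c ^+ 2) (@integrable_sqr_gaussian 2^-1 ltac:(lra)).
rewrite -(RintegralD measurableT i1 i2).
apply: le_Rintegral => //.
- exact: integrable_bounded_phi0 md d1.
- exact: (integrableD measurableT i1 i2).
move=> x _; apply: le_trans (ler_wpM2r (normal_pdf_ge0 _ _ _) (dev_sqr_le x)) _.
rewrite mulrDl lerD2l mulrA; apply: ler_wpM2l; last exact: normal_pdf01_le.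
by apply: mulr_ge0; [apply: mulr_ge0|]; rewrite ?sqr_ge0.
Qed.

Lemma dev_mean : `|\int[N]_x dev k c x| <=
  Phi k + 2 * c * \int[lam]_x (`|x| * expR (- (2^-1 * x ^+ 2))).
Proof.
have md := measurable_dev k c.
rewrite (Rintegral_normal_prob md dev_le1) Phi_lt -RintegralZl//; last first.
  exact: integrable_norm_gaussian.
have i1 := integrable_lt_phi0.
have i2 := integrableZ (2 * c) (@integrable_norm_gaussian 2^-1 ltac:(lra)).
have i3 := integrable_bounded_phi0 md dev_le1.
rewrite -(RintegralD measurableT i1 i2).
apply: le_trans (le_normr_Rintegral measurableT i3) _.
apply: le_Rintegral => //.
- exact: (integrable_norm i3).
- exact: (integrableD measurableT i1 i2).
move=> x _; rewrite normrM (ger0_norm (normal_pdf_ge0 _ _ _)).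
apply: le_trans (ler_wpM2r (normal_pdf_ge0 _ _ _) (dev_le x)) _.
rewrite mulrDl lerD2l mulrA; apply: ler_wpM2l; last exact: normal_pdf01_le.
by rewrite !mulr_ge0.
Qed.

(** Split the rate as [b' + (b - b')]: the first factor is at most its value at [h], the second
    remains integrable. *)
Lemma lt_gaussian_tail b b' h : 0 < b' < b -> h <= 0 ->
  \int[lam]_x ((x < h)%R%:R * expR (- (b * x ^+ 2))) <=
  expR (- (b' * h ^+ 2)) * \int[lam]_x expR (- ((b - b') * x ^+ 2)).
Proof.
move=> /andP[b'0 b'b] h0.
have bb : 0 < b - b' by rewrite subr_gt0.
rewrite -RintegralZl//; last exact: integrable_gaussian.
apply: le_Rintegral => //.
- apply: (@integrable_gaussian_dominated _ b 1); first exact: lt_trans b'b.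
    by apply: measurable_funM; [exact: measurable_lt|exact: measurable_gaussian].
  move=> x; rewrite normrM ler_pM// ?norm_bool_le1//.
  by rewrite ger0_norm ?expR_ge0.
- by apply: integrableZ; exact: integrable_gaussian.
move=> x _; case: ltP => xh /=; last by rewrite mul0r mulr_ge0 ?expR_ge0.
rewrite mul1r -expRD ler_expR.
suff : b' * h ^+ 2 <= b' * x ^+ 2 by lra.
by apply: ler_wpM2l; [exact: ltW|nra].
Qed.

Lemma dev_gaussian_mass b b' : 0 < b' < b -> k <= 0 ->
  \int[lam]_x (`|dev k c x| * expR (- (b * x ^+ 2))) <=
  expR (- (b' * k ^+ 2)) * \int[lam]_x expR (- ((b - b') * x ^+ 2)) +
  2 * c * \int[lam]_x (`|x| * expR (- (b * x ^+ 2))).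
Proof.
move=> bb k0; have /andP[b'0 b'b] := bb; have b0 := lt_trans b'0 b'b.
apply: le_trans (lerD (lt_gaussian_tail bb k0) (lexx _)).
have i1 : lam.-integrable setT
    (EFin \o (fun x => (x < k)%R%:R * expR (- (b * x ^+ 2)))).
  apply: (@integrable_gaussian_dominated _ b 1) => //.
    by apply: measurable_funM; [exact: measurable_lt|exact: measurable_gaussian].
  move=> x; rewrite normrM ler_pM// ?norm_bool_le1//.
  by rewrite ger0_norm ?expR_ge0.
have i2 := integrableZ (2 * c) (integrable_norm_gaussian b0).
rewrite -RintegralZl//; last exact: integrable_norm_gaussian.
rewrite -(RintegralD measurableT i1 i2); apply: le_Rintegral => //.
- apply: (@integrable_gaussian_dominated _ b 1) => //.
    apply: measurable_funM.
      by apply: measurableT_comp => //; exact: measurable_dev.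
    exact: measurable_gaussian.
  move=> x; rewrite normrM normr_id ler_pM// ?dev_le1//.
  by rewrite ger0_norm ?expR_ge0.
- exact: (integrableD measurableT i1 i2).
move=> x _; apply: le_trans (ler_wpM2r (expR_ge0 _) (dev_le x)) _.
by rewrite mulrDl [2 * c * (_ * _)]mulrA lexx.
Qed.

End fixed_c.

End deviation_bounds.

(** * Asymptotics as the threshold tends to minus infinity *)

Section asymptotics.
Context {R : realType}.
Notation lam := (@lebesgue_measure R).
Notation N := (normal_prob (0 : R) 1).
Notation phi0 := (normal_pdf (0 : R) 1).
Implicit Types (k c b : R).

Lemma near_ninfty_le (A : R) : \forall k \near -oo%R, k <= A.
Proof. exact: nbhs_ninfty_le (num_real A). Qed.

(** By [Phi_ge], [Phi k] is at least of order [exp (k - k^2 / 2)], so any Gaussian rate above [1/2]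
    loses against it. *)
Lemma Phi_dominates (g C : R) : 2^-1 < g ->
  \forall k \near -oo%R, C * expR (- (g * k ^+ 2)) <= Phi k.
Proof.
move=> g2; pose d := g - 2^-1; have d0 : 0 < d by rewrite subr_gt0.
pose p : R := normal_peak 1.
have p0 : 0 < p by exact: normal_peak_gt0.
near=> k.
have k1 : k <= 0 by near: k; exact: near_ninfty_le.
(* Through [1 + x <= exp x] the goal reduces to [C / p <= d k^2 + k + 1/2]. Here [k2] gives
   [d k^2 >= 2 |k|], [k3] and [k4] give [d k^2 >= 2 (C / p + 1)], and the average of the two
   suffices. *)
have k2 : k <= - (2 / d) by near: k; exact: near_ninfty_le.
have k3 : k <= - (2 * (C / p + 1) / d) by near: k; exact: near_ninfty_le.
have k4 : k <= -1 by near: k; exact: near_ninfty_le.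
apply: le_trans (Phi_ge k1).
rewrite normal_pdf01E -/p mulrC -ler_pdivlMl ?expR_gt0// -expRN.
rewrite mulrCA -expRD -ler_pdivrMl// mulrC.
apply: le_trans (expR_ge1Dx _).
have h2 : - k * d >= 2 by rewrite -ler_pdivrMr//; lra.
have h3 : - k * d >= 2 * (C / p + 1) by rewrite -ler_pdivrMr//; lra.
have -> : 1 + (- - (g * k ^+ 2) + - (2^-1 * (k - 1) ^+ 2)) = d * k ^+ 2 + k + 2^-1.
  by rewrite /d; field.
set D := C / p in h3 *.
have h4 : 2 * - k <= - k * d * - k by rewrite ler_wpM2r//; lra.
have h5 : 2 * (D + 1) * 1 <= - k * d * - k.
  have [D0|D0] := leP 0 (D + 1).
    by apply: ler_pM => //; lra.
  have : 0 <= - k * d * - k by rewrite mulr_ge0//; lra.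
  lra.
have e : - k * d * - k = d * k ^+ 2 by ring.
rewrite e in h4 h5; lra.
Unshelve. all: by end_near. Qed.

Lemma expR_sqr_cvg0 (g C e : R) : 0 < g -> 0 < e ->
  \forall k \near -oo%R, C * expR (- (g * k ^+ 2)) <= e.
Proof.
move=> g0 e0; near=> k.
have k1 : k <= -1 by near: k; exact: near_ninfty_le.
have k2 : k <= - (C / e / g) by near: k; exact: near_ninfty_le.
rewrite expRN ler_pdivrMr ?expR_gt0// -ler_pdivrMl// mulrC.
apply: le_trans (expR_ge1Dx _).
have h : - k * g >= C / e by rewrite -ler_pdivrMr//; lra.
have : - k * g <= - k * g * - k by rewrite ler_peMr//; [rewrite mulr_ge0 ?ltW//|]; lra.
have -> : - k * g * - k = g * k ^+ 2 by ring.
lra.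
Unshelve. all: by end_near. Qed.

Lemma Phi_cvg0 (e : R) : 0 < e -> \forall k \near -oo%R, Phi k <= e.
Proof.
move=> e0; near=> k.
have k0 : k <= 0 by near: k; exact: near_ninfty_le.
pose C : R := \int[lam]_x expR (- ((2^-1 - 4^-1) * x ^+ 2)).
have h : C * expR (- (4^-1 * k ^+ 2)) <= e.
  by near: k; exact: expR_sqr_cvg0.
apply: le_trans h; rewrite mulrC.
apply: le_trans (@lt_gaussian_tail _ 2^-1 4^-1 k _ k0); last by lra.
rewrite Phi_lt; apply: le_Rintegral => //.
- exact: integrable_lt_phi0.
- apply: (@integrable_gaussian_dominated _ 2^-1 1) => //.
    by apply: measurable_funM; [exact: measurable_lt|exact: measurable_gaussian].
  move=> x; rewrite normrM ler_pM// ?norm_bool_le1//.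
  by rewrite ger0_norm ?expR_ge0.
by move=> x _; apply: ler_wpM2l => //; exact: normal_pdf01_le.
Unshelve. all: by end_near. Qed.

(** [c_star_spec] is applied at [c1 = 4 * phi0 k]. Moving from [k] to [k + c1] multiplies the
    density by at most [exp (- c1 k) <= 2], while [1 - Phi (k + c1) >= 3/4]; so
    [c1 * (1 - Phi (k + c1))] is at least [3 * phi0 k], which exceeds [2 * phi0 k]. This is the
    origin of the factor 4. *)
Lemma c_star_asymptotics : \forall k \near -oo%R,
  [/\ 0 < c_star k, c_star k <= 4 * phi0 k, - (c_star k * k) <= ln 2 &
      \int[lam]_x (tilt k (c_star k) x * (x * phi0 x)) = 0].
Proof.
have l2 : 0 < ln 2 :> R by apply: ln_gt0; lra.
have Phi4 : \forall k \near -oo%R, Phi (k + 1 : R) <= 4^-1.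
  have [M [_ HM]] := @Phi_cvg0 4^-1 ltac:(lra).
  near=> k; apply: HM; suff : k <= M - 2 by lra.
  by near: k; exact: near_ninfty_le.
near=> k.
have k1 : k <= -1 by near: k; exact: near_ninfty_le.
have k2 : k <= - (8 / ln 2) by near: k; exact: near_ninfty_le.
have k3 : k <= -8 by near: k; exact: near_ninfty_le.
have f0 := normal_pdf01_gt0 k.
(* It yields [c1 |k| <= 8 / |k|], which [k2] brings below [ln 2], and [c1 <= 8 / k^2], which [k3]
   brings below 1. *)
have fk : phi0 k * k ^+ 2 <= 2.
  have h : phi0 k * expR (2^-1 * k ^+ 2) <= 1.
    apply: le_trans (ler_wpM2r (expR_ge0 _) (normal_pdf01_le k)) _.
    by rewrite mulrC expRxMexpNx_1.
  have := ler_wpM2l (ltW f0) (expR_ge1Dx (2^-1 * k ^+ 2)).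
  nra.
have kl : - k * ln 2 >= 8 by rewrite -ler_pdivrMr//; lra.
set c1 := 4 * phi0 k.
have c10 : 0 < c1 by rewrite mulr_gt0.
have ck : - (c1 * k) <= ln 2.
  have : - (c1 * k) * - k <= 8.
    have -> : - (c1 * k) * - k = 4 * (phi0 k * k ^+ 2) by rewrite /c1; ring.
    lra.
  move=> h; have : - (c1 * k) * - k <= ln 2 * - k by lra.
  by rewrite ler_pM2r//; lra.
have c11 : c1 <= 1.
  have : c1 * 64 <= 8; last by lra.
  apply: (@le_trans _ _ (c1 * k ^+ 2)); last by rewrite /c1; lra.
  by apply: ler_wpM2l; [exact: ltW|nra].
have H : phi0 (k + c1) < c1 * (1 - Phi (k + c1)).
  have P4 : Phi (k + c1) <= 4^-1.
    have h1 : k + c1 <= k + 1 by lra.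
    have /andP[h2 _] := Phi_lipschitz h1.
    have h3 : Phi (k + 1) <= 4^-1 by near: k.
    lra.
  have f2 : phi0 (k + c1) <= 2 * phi0 k.
    rewrite !normal_pdf01E [leRHS]mulrCA; apply: ler_wpM2l; first exact: normal_peak_ge0.
    rewrite [X in _ <= X * _](_ : 2 = expR (ln 2)); last by rewrite lnK ?posrE.
    rewrite -expRD ler_expR.
    have -> : - (2^-1 * (k + c1) ^+ 2) =
      - (c1 * k) - 2^-1 * c1 ^+ 2 - 2^-1 * k ^+ 2 by field.
    by have := sqr_ge0 c1; lra.
  apply: le_lt_trans f2 _.
  have : c1 * 4^-1 * 3 <= c1 * (1 - Phi (k + c1)).
    by rewrite -mulrA; apply: ler_wpM2l; [exact: ltW|lra].
  by rewrite /c1; lra.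
have [cs0 cs1 M0] := c_star_spec c10 H.
split => //; first exact: ltW.
apply: le_trans ck; rewrite lerN2; nra.
Unshelve. all: by end_near. Qed.

(** [c_star k] is of order at most [exp (- k^2 / 2)], so its square has Gaussian rate 1, twice that
    of [Phi k]. *)
Lemma c_star_sqr_dominated (C : R) : 0 <= C ->
  \forall k \near -oo%R, C * c_star k ^+ 2 <= Phi k.
Proof.
move=> C0; near=> k.
have [c0 c4 _ _] : [/\ 0 < c_star k, c_star k <= 4 * phi0 k,
    - (c_star k * k) <= ln 2 &
    \int[lam]_x (tilt k (c_star k) x * (x * phi0 x)) = 0].
  by near: k; exact: c_star_asymptotics.
have h : C * 16 * expR (- (1 * k ^+ 2)) <= Phi k.
  by near: k; apply: Phi_dominates; lra.
apply: le_trans h; rewrite -mulrA; apply: ler_wpM2l => //.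
have h : c_star k <= 4 * expR (- (2^-1 * k ^+ 2)).
  by apply: le_trans c4 _; apply: ler_wpM2l => //; exact: normal_pdf01_le.
have -> : 16 * expR (- (1 * k ^+ 2)) = (4 * expR (- (2^-1 * k ^+ 2))) ^+ 2.
  rewrite exprMn expr2 -!expr2 -expRM_natl.
  by congr (_ * expR _); [ring|field].
by rewrite lerXn2r// nnegrE ?(ltW c0)// mulr_ge0// expR_ge0.
Unshelve. all: by end_near. Qed.

Lemma c_star_cvg0 (e : R) : 0 < e -> \forall k \near -oo%R, c_star k <= e.
Proof.
move=> e0; near=> k.
have [c0 c4 _ _] : [/\ 0 < c_star k, c_star k <= 4 * phi0 k,
    - (c_star k * k) <= ln 2 &
    \int[lam]_x (tilt k (c_star k) x * (x * phi0 x)) = 0].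
  by near: k; exact: c_star_asymptotics.
have h : 4 * expR (- (2^-1 * k ^+ 2)) <= e.
  by near: k; apply: expR_sqr_cvg0 => //; lra.
by apply: le_trans h; apply: le_trans c4 _; apply: ler_wpM2l => //; exact: normal_pdf01_le.
Unshelve. all: by end_near. Qed.

(** With [b'] strictly between [1/4] and [b], the square of the tail part has rate [2 b' > 1/2]; the
    other part is of order [c_star k]. [Phi_dominates] and [c_star_sqr_dominated] control the two
    squares. *)
Lemma dev_mass_dominated (b C : R) : 4^-1 < b -> 0 <= C ->
  \forall k \near -oo%R,
    C * (\int[lam]_x (`|dev k (c_star k) x| * expR (- (b * x ^+ 2)))) ^+ 2 <= Phi k.
Proof.
move=> b4 C0; pose b' := (b + 4^-1) / 2.
have bb : 0 < b' < b by rewrite /b'; apply/andP; split; lra.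
pose A : R := \int[lam]_x expR (- ((b - b') * x ^+ 2)).
pose B : R := \int[lam]_x (`|x| * expR (- (b * x ^+ 2))).
have A0 : 0 <= A by apply: Rintegral_ge0 => x _; exact: expR_ge0.
have B0 : 0 <= B by apply: Rintegral_ge0 => x _; rewrite mulr_ge0 ?expR_ge0.
near=> k.
have k0 : k <= 0 by near: k; exact: near_ninfty_le.
have [c0 _ ck _] : [/\ 0 < c_star k, c_star k <= 4 * phi0 k,
    - (c_star k * k) <= ln 2 &
    \int[lam]_x (tilt k (c_star k) x * (x * phi0 x)) = 0].
  by near: k; exact: c_star_asymptotics.
(* Since [(u + v)^2 <= 2 (u^2 + v^2)], each square times [C] is allotted a quarter of [Phi k]; the
   [16] below is this [4] times the square of the factor 2 in [v]. *)
have h1 : 4 * C * A ^+ 2 * expR (- ((2 * b') * k ^+ 2)) <= Phi k.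
  by near: k; apply: Phi_dominates; rewrite /b'; lra.
have h2 : 16 * C * B ^+ 2 * c_star k ^+ 2 <= Phi k.
  by near: k; apply: c_star_sqr_dominated; rewrite !mulr_ge0.
have := dev_gaussian_mass (ltW c0) ck bb k0; rewrite -/A -/B.
set W := \int[lam]_x _.
have W0 : 0 <= W by apply: Rintegral_ge0 => x _; rewrite mulr_ge0 ?expR_ge0.
have eE : expR (- (2 * b' * k ^+ 2)) = expR (- (b' * k ^+ 2)) ^+ 2.
  by rewrite -expRM_natl; congr expR; ring.
rewrite eE in h1; move: h1; set E := expR _ => h1 WAB.
have E0 : 0 <= E by exact: expR_ge0.
set u := E * A in WAB; set v := 2 * c_star k * B in WAB.
have u2 : C * u ^+ 2 * 4 <= Phi k by rewrite (_ : C * u ^+ 2 * 4 = 4 * C * A ^+ 2 * E ^+ 2)//; rewrite /u; ring.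
have v2 : C * v ^+ 2 * 4 <= Phi k.
  by rewrite (_ : C * v ^+ 2 * 4 = 16 * C * B ^+ 2 * c_star k ^+ 2)//; rewrite /v; ring.
have u0 : 0 <= u by rewrite mulr_ge0.
have v0 : 0 <= v by rewrite !mulr_ge0// ltW.
have W2 : W ^+ 2 <= 2 * (u ^+ 2 + v ^+ 2).
  have : W ^+ 2 <= (u + v) ^+ 2 by rewrite lerXn2r// nnegrE// addr_ge0.
  by have := sqr_ge0 (u - v); nra.
have := ler_wpM2l C0 W2; lra.
Unshelve. all: by end_near. Qed.

End asymptotics.

(** * Entropy and pair moments *)

Section entropy.
Context {R : realType}.
Implicit Types (p q s x : R).

Lemma ln2_gt0 : 0 < ln 2 :> R.
Proof. by apply: ln_gt0; lra. Qed.

Lemma ln_le_sub1 x : 0 < x -> ln x <= x - 1.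
Proof.
by move=> x0; have := @le_ln1Dx R (x - 1) ltac:(lra); rewrite addrC subrK.
Qed.

Lemma ln_ge_1subV x : 0 < x -> 1 - x^-1 <= ln x.
Proof.
move=> x0; have := @ln_le_sub1 x^-1; rewrite invr_gt0 lnV ?posrE// => /(_ x0).
lra.
Qed.

(** [ln s >= 1 - 1/s] is used at the square root: for [p = s^2] it gives [p ln p >= 2 p - 2 sqrt p].
    The plain bound [p ln p >= p - 1] would give no deficit when summed over [1 + q] and [1 - q],
    and would not vanish at [p = 0]. *)
Lemma mul_ln_ge s : 0 < s -> 2 * s ^+ 2 - 2 * s <= s ^+ 2 * ln (s ^+ 2).
Proof.
move=> s0; rewrite lnXn// mulr2n.
have := ler_wpM2l (sqr_ge0 s) (ln_ge_1subV s0).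
have -> : s ^+ 2 * (1 - s^-1) = s ^+ 2 - s by field; rewrite gt_eqF.
lra.
Qed.

Lemma Ent0 : Ent (0 : R) = 0.
Proof. by rewrite /Ent oppr0 mul0r addr0 ln1 mulr0 subrr. Qed.

Lemma EntC p : Ent (1 - p) = Ent p.
Proof. by rewrite /Ent subKr; ring. Qed.

Lemma Ent1 : Ent (1 : R) = 0.
Proof. by rewrite -EntC subrr Ent0. Qed.

Lemma Ent_half : Ent (2^-1 : R) = ln 2.
Proof.
rewrite /Ent; have -> : 1 - 2^-1 = 2^-1 :> R by lra.
by rewrite lnV ?posrE//; lra.
Qed.

(* With [s = sqrt (1 + q)] and [t = sqrt (1 - q)] the entropy deficit is at
   least [2 - s - t], because [ln s >= 1 - 1 / s]. *)
Lemma Ent_le q : -1 < q < 1 -> Ent ((1 + q) / 2) <= ln 2 - q ^+ 2 / 4.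
Proof.
move=> /andP[q1 q2].
have x0 : 0 < 1 + q by lra.
have y0 : 0 < 1 - q by lra.
pose s := Num.sqrt (1 + q); pose t := Num.sqrt (1 - q).
have s0 : 0 < s by rewrite sqrtr_gt0.
have t0 : 0 < t by rewrite sqrtr_gt0.
have s2 : s ^+ 2 = 1 + q by rewrite sqr_sqrtr// ltW.
have t2 : t ^+ 2 = 1 - q by rewrite sqr_sqrtr// ltW.
have hs := mul_ln_ge s0; have ht := mul_ln_ge t0.
rewrite s2 in hs; rewrite t2 in ht.
have -> : Ent ((1 + q) / 2) = ln 2 - ((1 + q) * ln (1 + q) + (1 - q) * ln (1 - q)) / 2.
  rewrite /Ent; have -> : 1 - (1 + q) / 2 = (1 - q) / 2 by field.
  by rewrite !ln_div ?posrE//; field.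
suff : s + t <= 2 - q ^+ 2 / 4 by lra.
(* [s t = sqrt (1 - q^2)], so [(s + t)^2 = 2 + 2 s t <= 4 - q^2 <= (2 - q^2 / 4)^2]. *)
have st : s * t <= 1 - q ^+ 2 / 2.
  have st0 : 0 <= s * t by rewrite mulr_ge0 ?ltW.
  have st2 : (s * t) ^+ 2 = 1 - q ^+ 2 by rewrite exprMn s2 t2; ring.
  have h0 : 0 <= 1 - q ^+ 2 / 2 by nra.
  rewrite -(@ler_pXn2r _ 2) ?nnegrE// st2.
  have := sqr_ge0 (q ^+ 2); nra.
have h0 : 0 <= 2 - q ^+ 2 / 4 by nra.
have h1 : (s + t) ^+ 2 <= (2 - q ^+ 2 / 4) ^+ 2.
  have -> : (s + t) ^+ 2 = s ^+ 2 + t ^+ 2 + 2 * (s * t) by ring.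
  rewrite s2 t2; have := sqr_ge0 (q ^+ 2); nra.
by rewrite -(@ler_pXn2r _ 2) ?nnegrE// addr_ge0// ltW.
Qed.

(** [mul_ln_ge] at [s = sqrt p] gives [- p ln p <= 2 sqrt p - 2 p], and the other entropy term is at
    most [p]. *)
Lemma Ent_le_sqrt p : 0 <= p < 1 -> Ent p <= 3 * Num.sqrt p.
Proof.
move=> /andP[]; rewrite le_eqVlt => /predU1P[<- _|p0 p1].
  by rewrite Ent0 sqrtr0 mulr0.
pose s := Num.sqrt p.
have s0 : 0 < s by rewrite sqrtr_gt0.
have s2 : s ^+ 2 = p by rewrite sqr_sqrtr// ltW.
have hs := mul_ln_ge s0; rewrite s2 in hs.
have y0 : 0 < 1 - p by lra.
have := ler_wpM2l (ltW y0) (ln_ge_1subV y0).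
have -> : (1 - p) * (1 - (1 - p)^-1) = - p by field; rewrite gt_eqF.
rewrite /Ent -/s; nra.
Qed.

Lemma Ent_small (e : R) : 0 < e -> exists2 r : R, 0 < r < 1 &
  forall q, -1 <= q <= 1 -> r <= `|q| -> Ent ((1 + q) / 2) <= e.
Proof.
(* For [p = (1 - |q|) / 2], the second entry of the maximum gives [p <= (e / 3)^2], hence
   [3 sqrt p <= e]; the first entry keeps [r] positive when [e] is large. *)
move=> e0; pose r : R := Num.max 2^-1 (1 - 2 * (e / 3) ^+ 2).
have e2 : 0 < (e / 3) ^+ 2 by rewrite exprn_gt0// divr_gt0.
have r1 : 2^-1 <= r by rewrite le_max lexx.
have r2 : 1 - 2 * (e / 3) ^+ 2 <= r by rewrite le_max lexx orbT.
have r3 : r < 1 by rewrite gt_max; apply/andP; split; lra.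
exists r; first by apply/andP; split; lra.
have key p : 0 <= p -> p <= (1 - r) / 2 -> Ent p <= e.
  move=> p0 pr; apply: (le_trans (Ent_le_sqrt _)).
    by apply/andP; split; lra.
  have : Num.sqrt p <= e / 3.
    have pe : p <= (e / 3) ^+ 2 by lra.
    have := ler_wsqrtr pe; rewrite sqrtr_sqr ger0_norm//.
    by rewrite divr_ge0// ltW.
  lra.
move=> q /andP[q1 q2] rq.
have [q0|q0] := leP 0 q.
  rewrite -EntC; apply: key; first lra.
  by move: rq; rewrite ger0_norm//; lra.
by apply: key; first lra; move: rq; rewrite ltr0_norm//; lra.
Qed.

End entropy.

(** * The pair moment in terms of the deviation *)

Section pair_moments.
Context {R : realType}.
Notation lam := (@lebesgue_measure R).
Notation N := (normal_prob (0 : R) 1).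
Notation phi0 := (normal_pdf (0 : R) 1).
Variable k : R.
Let c := c_star k.
Let u := dev k c.
Hypothesis c0 : 0 <= c.
Hypothesis ck : - (c * k) <= ln 2.

Lemma pair_momentE q :
  pair_moment k q = \int[std_normal2]_z (tilt k c z.1 * tilt k c (G2 q z)).
Proof.
rewrite /pair_moment unlock; apply: eq_Rintegral => z _.
rewrite indicE /tilt /G1.
have -> : (z \in [set w : R * R | k <= w.1 /\ k <= G2 q w]) =
    (k <= z.1) && (k <= G2 q z).
  by apply/idP/idP; [rewrite inE => -[-> ->]|rewrite inE => /andP[]].
rewrite mulNr mulrDr opprD expRD.
case: (k <= z.1); case: (k <= G2 q z); rewrite /=; ring.
Qed.

Let tiltE x : tilt k c x = 1 + u x.
Proof. by rewrite /u /dev addrC subrK. Qed.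

Let mu : measurable_fun [set: R] u.
Proof. exact: measurable_dev. Qed.

Let u1 x : `|u x| <= 1.
Proof. exact: dev_le1. Qed.

Lemma pair_moment_dev q : -1 <= q <= 1 -> pair_moment k q =
  1 + 2 * \int[N]_x u x + \int[std_normal2]_z (u z.1 * u (G2 q z)).
Proof.
move=> q1; rewrite pair_momentE -cross_moment1//.
by apply: eq_Rintegral => z _; rewrite !tiltE.
Qed.

Lemma pairing_0 : pairing u 0 = (\int[N]_x u x) ^+ 2.
Proof. by rewrite pairing0// -(Rintegral_normal_prob mu u1). Qed.

Lemma pair_moment0 : pair_moment k 0 = (1 + \int[N]_x u x) ^+ 2.
Proof.
rewrite pair_moment_dev; last by apply/andP; split; lra.
rewrite cross_moment_pairing// ?expr0n ?ltr01//= pairing_0; ring.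
Qed.

(** The standard normal has mean zero, so [u] and the tilt have the same first moment, which the
    equation for [c_star] makes zero. *)
Lemma pairing_d1_u0 :
  \int[lam]_x (tilt k c x * (x * phi0 x)) = 0 -> pairing_d1 u 0 = 0.
Proof.
move=> M0; rewrite pairing_d1_0//.
suff -> : \int[lam]_x (u x * (x * phi0 x)) = 0 by rewrite expr0n.
have i1 : lam.-integrable setT (EFin \o (fun x => tilt k c x * (x * phi0 x))).
  apply: (integrable_bounded_mul_phi0 (measurable_tilt k c)) => x.
  exact: norm_tilt_le.
have i2 : lam.-integrable setT (EFin \o (fun x => 1 * (x * phi0 x))).
  apply: (@integrable_bounded_mul_phi0 _ (cst 1) 1) => // x.
  by rewrite /= normr1.
transitivity (\int[lam]_x (tilt k c x * (x * phi0 x) - 1 * (x * phi0 x))).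
  by apply: eq_Rintegral => x _; rewrite tiltE; ring.
rewrite (RintegralB measurableT i1 i2) M0 sub0r.
under eq_Rintegral do rewrite mul1r.
by rewrite Rintegral_mul_phi0 oppr0.
Qed.

(* Cauchy-Schwarz for the tilt and the indicator of its support. *)
Lemma pair_moment1_ge : 0 < 1 - Phi k ->
  (1 + \int[N]_x u x) ^+ 2 <= pair_moment k 1 * (1 - Phi k).
Proof.
move=> P0; set M := 1 + _; set P := 1 - Phi k in P0 *; set F := pair_moment k 1.
pose I x : R := (k <= x)%R%:R.
have mI : measurable_fun [set: R] I := measurable_ge k.
have I1 x : `|I x| <= 1 by exact: norm_bool_le1.
have mt : measurable_fun [set: R] (tilt k c) := measurable_tilt k c.
have t2 x : `|tilt k c x| <= 2.
  by rewrite tiltE; apply: le_trans (ler_normD _ _) _; rewrite normr1; have := u1 x; lra.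
have tt4 x : `|tilt k c x ^+ 2| <= 4.
  rewrite normrX; have -> : 4 = 2 ^+ 2 :> R by ring.
  by rewrite lerXn2r// nnegrE.
have mtt : measurable_fun [set: R] (fun x => tilt k c x ^+ 2) by exact: measurable_funX.
have iu : N.-integrable setT (EFin \o u) by apply: (@integrable_bounded _ _ _ _ _ 1).
have it : N.-integrable setT (EFin \o tilt k c).
  by apply: (@integrable_bounded _ _ _ _ _ 2).
have iI : N.-integrable setT (EFin \o I) by apply: (@integrable_bounded _ _ _ _ _ 1).
have itt : N.-integrable setT (EFin \o (fun x => tilt k c x ^+ 2)).
  by apply: (@integrable_bounded _ _ _ _ _ 4).
have FE : F = \int[N]_x (tilt k c x ^+ 2).
  rewrite /F pair_momentE -(Rintegral_G1 mtt tt4); apply: eq_Rintegral => z _.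
  by rewrite /G2 mul1r expr1n subrr sqrtr0 mul0r addr0 expr2.
have ME : M = \int[N]_x tilt k c x.
  have ic : N.-integrable setT (EFin \o (fun=> 1 : R)).
    exact: finite_measure_integrable_cst.
  transitivity (\int[N]_x (1 + u x)); last by apply: eq_Rintegral => x _; rewrite tiltE.
  rewrite (RintegralD measurableT ic iu) Rintegral_cst//=.
  rewrite [X in fine X](_ : _ = 1%E) /= ?mulr1; last exact: integral_normal_pdf.
  by [].
have PE : P = \int[N]_x I x by rewrite (Rintegral_normal_prob mI I1) /P one_sub_Phi.
have iN (f : R -> R) (a : R) : N.-integrable setT (EFin \o f) ->
    N.-integrable setT (EFin \o (fun x => a * f x)).
  move=> ifx; have -> : EFin \o (fun x => a * f x) = (fun x => a%:E * (EFin \o f) x)%E.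
    by apply/funext => x /=; rewrite EFinM.
  exact: integrableZl.
(* This is the expectation of [(tilt - a I)^2], expanded with [tilt * I = tilt] and [I^2 = I]; the
   minimising choice [a = M / P] gives the inequality. *)
have quad a : 0 <= F - 2 * a * M + a ^+ 2 * P.
  have j1 := iN _ (2 * a) it; have j2 := iN _ (a ^+ 2) iI.
  have j3 := integrableB measurableT itt j1.
  rewrite FE ME PE -(RintegralZl _ measurableT it) -(RintegralZl _ measurableT iI).
  rewrite -(RintegralB measurableT itt j1) -(RintegralD measurableT j3 j2).
  apply: Rintegral_ge0 => x _.
  have -> : tilt k c x ^+ 2 - 2 * a * tilt k c x + a ^+ 2 * I x =
      (tilt k c x - a * I x) ^+ 2.
    by rewrite /tilt /I; case: (k <= x); rewrite /=; ring.
  exact: sqr_ge0.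
have := quad (M / P).
have -> : F - 2 * (M / P) * M + (M / P) ^+ 2 * P = F - M ^+ 2 / P.
  by field; rewrite gt_eqF.
by rewrite subr_ge0 ler_pdivrMr.
Qed.

End pair_moments.

(** * The two thresholds *)

Section thresholds.
Context {R : realType}.
Notation lam := (@lebesgue_measure R).
Notation N := (normal_prob (0 : R) 1).
Notation phi0 := (normal_pdf (0 : R) 1).
Implicit Types (k a q : R).

Lemma alpha_up_le k : 0 < Phi k < 1 -> alpha_up k <= ln 2 / Phi k.
Proof.
move=> /andP[P0 P1]; have P1' : 0 < 1 - Phi k by lra.
have h : ln (1 - Phi k) <= - Phi k by have := ln_le_sub1 P1'; lra.
rewrite /alpha_up mulNr -mulrN -invrN; apply: ler_wpM2l; first exact: ltW ln2_gt0.
by rewrite lef_pV2 ?posrE//; lra.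
Qed.

(** The nonvanishing mean makes both pair moments positive, so that the two logarithms are genuine
    and not default values. *)
Lemma admissible_lt_alpha_up k a : 0 <= c_star k -> - (c_star k * k) <= ln 2 ->
  0 < Phi k < 1 -> 1 + \int[N]_x dev k (c_star k) x != 0 ->
  admissible k a -> a <= alpha_up k.
Proof.
move=> c0 ck /andP[P0 P1] M0 [a0 Hq _].
have := Hq 1; rewrite lexx oner_neq0 andbT => /(_ ltac:(lra) isT).
have P1' : 0 < 1 - Phi k by lra.
have CS := pair_moment1_ge c0 ck P1'.
rewrite /Psi pair_moment0// addr0 (_ : (1 + 1) / 2 = 1) ?mul1r; last by field.
rewrite Ent1 Ent_half; set M := 1 + _ in M0 CS *; set F := pair_moment k 1 in CS *.
have M2 : 0 < M ^+ 2 by rewrite exprn_even_gt0.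
have F0 : 0 < F.
  have : 0 < F * (1 - Phi k) by exact: lt_le_trans CS.
  by rewrite pmulr_lgt0.
have h : ln (M ^+ 2) - ln F <= ln (1 - Phi k).
  by rewrite lerBlDl -lnM ?posrE// ler_ln ?posrE// mulr_gt0.
have l1 : ln (1 - Phi k) < 0 by apply: ln_lt0; apply/andP; split; lra.
move=> H; rewrite /alpha_up mulNr -mulrN -invrN ler_pdivlMr; last lra.
have := ler_wpM2l (ltW a0) h; lra.
Qed.

Lemma is_derive_Psi_Ent q : -1 < q < 1 ->
  is_derive q 1 (fun q => Ent ((1 + q) / 2)) ((ln (1 - q) - ln (1 + q)) / 2).
Proof.
move=> /andP[q1 q2].
have x0 : 0 < 1 + q by lra.
have y0 : 0 < 1 - q by lra.
pose A (t : R) : R := 1 + t; pose B (t : R) : R := 1 - t.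
have dA : is_derive q 1 A (0 + 1) := is_derive1D (is_derive1_cst 1 q) (is_derive1_id q).
have dB : is_derive q 1 B (0 - 1) := is_derive1B (is_derive1_cst 1 q) (is_derive1_id q).
have H1 := is_derive1M dA (@is_derive1_comp_ln _ A q _ x0 dA).
have H2 := is_derive1M dB (@is_derive1_comp_ln _ B q _ y0 dB).
have H := is_derive1D (is_derive1_cst (ln 2) q)
  (is_derive1Ml (- 2^-1) (is_derive1D H1 H2)).
have near_eq : \forall t \near q,
    ln 2 + - 2^-1 * (A t * ln (A t) + B t * ln (B t)) = Ent ((1 + t) / 2).
  have nI : \forall t \near q, t \in `]-1, 1[%R.
    by apply: near_in_itvoo; rewrite in_itv/=; apply/andP.
  near=> t.
  have /andP[t1 t2] : -1 < t < 1.
    suff : t \in `]-1, 1[%R by rewrite in_itv.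
    by near: t.
  rewrite /Ent /A /B; have -> : 1 - (1 + t) / 2 = (1 - t) / 2 by field.
  by rewrite !ln_div ?posrE//; [field|lra|lra].
have := near_eq_is_derive near_eq H.
move=> H'; apply: (is_derive_eq H'); rewrite /A /B; field.
by apply/andP; split; rewrite gt_eqF.
Unshelve. all: by end_near. Qed.

Section fixed_k.
Variables (k r b C : R).
Let u := dev k (c_star k).
Let m := \int[N]_x u x.
Let W := \int[lam]_x (`|u x| * expR (- (b * x ^+ 2))).
Hypothesis c0 : 0 < c_star k.
Hypothesis ck : - (c_star k * k) <= ln 2.
Hypothesis M0 : \int[lam]_x (tilt k (c_star k) x * (x * phi0 x)) = 0.
Hypothesis r01 : 0 < r < 1.
Hypothesis b0 : 0 < b.
Hypothesis C0 : 0 <= C.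
Hypothesis dom : forall q x y, `|q| <= r ->
  let w := C * (expR (- (b * x ^+ 2)) * expR (- (b * y ^+ 2))) in
  [/\ bvn_pdf q (x, y) <= w,
      `|bvn_d1 q (x, y) * bvn_pdf q (x, y)| <= w &
      `|(bvn_d1 q (x, y) ^+ 2 + bvn_d2 q (x, y)) * bvn_pdf q (x, y)| <= w].
Hypothesis m_pos : 0 < 1 + m.

Let mu : measurable_fun [set: R] u.
Proof. exact: measurable_dev. Qed.

Let u1 x : `|u x| <= 1.
Proof. by apply: dev_le1 => //; exact: ltW. Qed.

Let rI q : `]-r, r[%classic q -> -1 < q < 1 /\ q ^+ 2 < 1.
Proof.
by rewrite /= in_itv/= => /andP[? ?]; have /andP[? ?] := r01; split; [lra|nra].
Qed.

Lemma pair_moment_pairing q : `]-r, r[%classic q ->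
  pair_moment k q = (1 + m) ^+ 2 + (pairing u q - pairing u 0).
Proof.
move=> /rI[/andP[q1 q2] q3].
rewrite (pair_moment_dev (ltW c0) ck); last by rewrite !ltW.
rewrite cross_moment_pairing// (pairing_0 (ltW c0) ck) -/u -/m; ring.
Qed.

Lemma pair_moment_growth q : `]-r, r[%classic q ->
  pair_moment k q <= (1 + m) ^+ 2 + C * W ^+ 2 * q ^+ 2.
Proof.
move=> qr; rewrite pair_moment_pairing// lerD2l.
have := pairing_growth mu u1 r01 b0 C0 dom (pairing_d1_u0 (ltW c0) ck M0) qr.
exact: le_trans (ler_norm _).
Qed.

(** Near 0, [Psi' = a U' / F + (ln (1 - q) - ln (1 + q)) / 2]. On differentiating once more, the
    term in [U'^2] drops because [U'] vanishes at 0, and the entropy contributes [-1]. *)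
Lemma derive2_Psi a : derive1n 2 (Psi k a) 0 =
  a * (pairing_d2 u 0 / (1 + m) ^+ 2) - 1.
Proof.
have r0 : 0 < r by have /andP[] := r01.
have r00 : `]-r, r[%classic (0 : R) by rewrite /= in_itv/=; apply/andP; split; lra.
pose F q := (1 + m) ^+ 2 + (pairing u q - pairing u 0).
have F0 : F 0 = (1 + m) ^+ 2 by rewrite /F subrr addr0.
have F0_gt0 : 0 < F 0 by rewrite F0 exprn_gt0.
have dF q : `]-r, r[%classic q -> is_derive q 1 F (pairing_d1 u q).
  move=> qr; have H := is_derive1D (is_derive1_cst ((1 + m) ^+ 2) q)
    (is_derive1B (is_derive_pairing mu u1 r01 b0 C0 dom qr)
                 (is_derive1_cst (pairing u 0) q)).
  by apply: (is_derive_eq H); ring.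
have nearI : \forall q \near (0 : R), `]-r, r[%classic q.
  apply: near_in_itvoo; rewrite in_itv/=; apply/andP; split; lra.
have F_near : \forall q \near (0 : R), 0 < F q.
  have [dF0 _] := dF 0 r00.
  have cF : F q @[q --> (0 : R)] --> F 0.
    by apply/differentiable_continuous/derivable1_diffP.
  exact: (cvgr_gt (F 0) cF).
pose Psi1 q := a * (pairing_d1 u q / F q) + (ln (1 - q) - ln (1 + q)) / 2.
(* [derive1n 2] differentiates the function [derive1 (Psi k a)], so the first derivative is needed
   on a whole neighbourhood of 0. [nI2] supplies around each [q] near 0 a neighbourhood on which
   [Psi] has its explicit form. *)
have dPsi : \forall q \near (0 : R), Psi1 q = derive1 (Psi k a) q.
  have nI2 := near_join nearI.
  near=> q.
  have qr : `]-r, r[%classic q by near: q.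
  have Fq : 0 < F q by near: q.
  have [qI _] := rI qr.
  have H := is_derive1D (is_derive1D
    (is_derive1Ml a (@is_derive1_comp_ln _ F q _ Fq (dF q qr)))
    (is_derive_Psi_Ent qI)) (is_derive1_cst (ln 2) q).
  have near_eq : \forall t \near q, a * ln (F t) + Ent ((1 + t) / 2) + ln 2 = Psi k a t.
    have : \forall t \near q, `]-r, r[%classic t by near: q.
    apply: filterS => t tr.
    by rewrite /Psi pair_moment_pairing.
  have [_ D] := near_eq_is_derive near_eq H.
  by rewrite derive1E D /Psi1 addr0.
rewrite /derive1n/= derive1E.
have dB : is_derive (0 : R) 1 (fun t : R => 1 - t) (0 - 1) :=
  is_derive1B (is_derive1_cst 1 0) (is_derive1_id 0).
have dA : is_derive (0 : R) 1 (fun t : R => 1 + t) (0 + 1) :=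
  is_derive1D (is_derive1_cst 1 0) (is_derive1_id 0).
have B0 : 0 < 1 - (0 : R) by rewrite subr0.
have A0 : 0 < 1 + (0 : R) by rewrite addr0.
have F0n : F 0 != 0 by rewrite gt_eqF.
have H := is_derive1D
  (is_derive1Ml a (is_derive1M (is_derive_pairing_d1 mu u1 r01 b0 C0 dom r00)
    (@is_derive1V _ F 0 _ F0n (dF 0 r00))))
  (is_derive1M (is_derive1B (@is_derive1_comp_ln _ (fun t => 1 - t) 0 _ B0 dB)
     (@is_derive1_comp_ln _ (fun t => 1 + t) 0 _ A0 dA)) (is_derive1_cst 2^-1 0)).
have [_ ->] := near_eq_is_derive dPsi H.
rewrite (pairing_d1_u0 (ltW c0) ck M0) F0 !subr0 !addr0 ?add0r ?mul0r ?mulr0 ?add0r.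
by congr (_ + _); field.
Unshelve. all: by end_near. Qed.

End fixed_k.

End thresholds.

(** * Admissibility near the critical scale and the resulting sandwich *)

Section main_bounds.
Context {R : realType}.
Notation lam := (@lebesgue_measure R).
Notation N := (normal_prob (0 : R) 1).
Notation phi0 := (normal_pdf (0 : R) 1).
Implicit Types (k a q : R).

Lemma near_regime (e : R) : 0 < e -> e <= 1 -> \forall k \near -oo%R,
  [/\ 0 < c_star k, - (c_star k * k) <= ln 2,
      \int[lam]_x (tilt k (c_star k) x * (x * phi0 x)) = 0,
      0 < Phi k <= e &
      `|\int[N]_x dev k (c_star k) x| <= 2 * e /\
      \int[N]_x (dev k (c_star k) x ^+ 2) <= (1 + e) * Phi k].
Proof.
move=> e0 e1.
pose m1 : R := \int[lam]_x (`|x| * expR (- (2^-1 * x ^+ 2))).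
pose m2 : R := \int[lam]_x (x ^+ 2 * expR (- (2^-1 * x ^+ 2))).
have m10 : 0 <= m1 by apply: Rintegral_ge0 => x _; rewrite mulr_ge0 ?expR_ge0.
have m20 : 0 <= m2.
  by apply: Rintegral_ge0 => x _; apply: mulr_ge0; rewrite ?sqr_ge0 ?expR_ge0.
near=> k.
have k0 : k <= 0 by near: k; exact: near_ninfty_le.
have [c0 _ ck M0] : [/\ 0 < c_star k, c_star k <= 4 * phi0 k,
    - (c_star k * k) <= ln 2 &
    \int[lam]_x (tilt k (c_star k) x * (x * phi0 x)) = 0].
  by near: k; exact: c_star_asymptotics.
have P0 : 0 < Phi k by apply: lt_le_trans (Phi_ge k0); exact: normal_pdf01_gt0.
have Pe : Phi k <= e by near: k; exact: Phi_cvg0.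
(* The mean is at most [Phi k + 2 c m1], and this bounds the second term by [e]; the [+ 1] keeps the
   denominator positive. Likewise [cm2] bounds [4 c^2 m2] by [e * Phi k]. *)
have cm1 : c_star k <= e / (2 * m1 + 1).
  by near: k; apply: c_star_cvg0; rewrite divr_gt0//; lra.
have cm2 : 4 * m2 / e * c_star k ^+ 2 <= Phi k.
  by near: k; apply: c_star_sqr_dominated; rewrite divr_ge0 ?mulr_ge0// ltW.
split => //; first by rewrite P0.
split.
- apply: le_trans (dev_mean (ltW c0) ck) _; rewrite -/m1.
  move: cm1; rewrite ler_pdivlMr; last lra.
  have := ltW c0; nra.
- apply: le_trans (dev_second_moment (ltW c0) ck) _; rewrite -/m2.
  rewrite (_ : (1 + e) * Phi k = Phi k + e * Phi k) ?lerD2l; last by ring.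
  have -> : 4 * c_star k ^+ 2 * m2 = e * (4 * m2 / e * c_star k ^+ 2).
    by field; rewrite gt_eqF.
  by apply: ler_wpM2l => //; exact: ltW.
Unshelve. all: by end_near. Qed.

Lemma alpha_low_le_up : \forall k \near -oo%R,
  (alpha_low (k : R) <= (alpha_up k)%:E)%E /\ alpha_up k <= ln 2 / Phi k.
Proof.
near=> k.
(* The value [1/4] keeps [1 + m] at least [1/2], hence nonzero, and [Phi k] below 1. *)
have [c0 ck M0 /andP[P0 P1] [mB _]] : [/\ 0 < c_star k, - (c_star k * k) <= ln 2,
      \int[lam]_x (tilt k (c_star k) x * (x * phi0 x)) = 0,
      0 < Phi k <= 4^-1 &
      `|\int[N]_x dev k (c_star k) x| <= 2 * 4^-1 /\
      \int[N]_x (dev k (c_star k) x ^+ 2) <= (1 + 4^-1) * Phi k].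
  by near: k; apply: near_regime; lra.
have P01 : 0 < Phi k < 1 by rewrite P0; lra.
split; last exact: alpha_up_le.
apply: ge_ereal_sup => _ [a Ha <-]; rewrite lee_fin.
apply: admissible_lt_alpha_up (ltW c0) ck P01 _ Ha.
by move: mB; rewrite ler_norml => /andP[? ?]; rewrite gt_eqF//; lra.
Unshelve. all: by end_near. Qed.

(** [ln F - ln M <= F / M - 1 <= Y / M]: an increase of the pair moment by [Y] raises [Psi] through
    its logarithm by at most [a Y / M]. *)
Lemma mul_ln_le (a F M Y : R) : 0 <= a -> 0 < F -> 0 < M -> F <= M + Y ->
  a * ln F <= a * ln M + a * Y / M.
Proof.
move=> a0 F0 M0 FY.
have := ln_le_sub1 (divr_gt0 F0 M0); rewrite ln_div ?posrE// => h.
have h2 : F / M - 1 <= Y / M.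
  rewrite lerBlDr (_ : Y / M + 1 = (Y + M) / M); last by field; rewrite gt_eqF.
  by rewrite ler_pM2r ?invr_gt0// addrC.
have := ler_wpM2l a0 (le_trans h h2).
by rewrite mulrBr mulrA lerBlDl.
Qed.

Let mean_bounds (m t : R) : `|m| <= 2 * t -> t <= 16^-1 ->
  0 < 1 + m /\ 1 - 4 * t <= (1 + m) ^+ 2.
Proof.
rewrite ler_norml => /andP[mL mU] t16; have := sqr_ge0 m.
by split; [lra|nra].
Qed.

(** Here [M >= 3/4], so the gain is at most [x / 6], against the entropy deficit [x / 4] for
    [x = q^2]. *)
Let small_q_bound (D M t x : R) : 0 < x -> D <= 8^-1 -> t <= 16^-1 ->
  1 - 4 * t <= M -> D * x / M < x / 4.
Proof.
move=> x0 D8 t16 tM; have M0 : 0 < M by lra.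
rewrite ltr_pdivrMr//.
have h1 : D * x <= 8^-1 * x by rewrite ler_pM2r.
have h2 : x * (3 / 4) <= x * M by rewrite ler_pM2l//; lra.
lra.
Qed.

(** Rests on [(1 - e) (1 + e/16) <= (1 - e/2) (1 - e/4)]: at the scale [e/16], all relative errors
    together eat at most half of the margin [e]. *)
Let large_q_bound (e l X M : R) : 0 < e < 1 -> 0 < l -> 1 - 4 * (e / 16) <= M ->
  X <= (1 - e) * l * (1 + e / 16) -> X / M <= (1 - e / 2) * l.
Proof.
move=> /andP[e0 e1] l0 eM hX; have M0 : 0 < M by lra.
rewrite ler_pdivrMr//; apply: le_trans hX _.
have h2 : (1 - e / 2) * l * (1 - 4 * (e / 16)) <= (1 - e / 2) * l * M.
  by apply: ler_wpM2l => //; rewrite mulr_ge0 ?(ltW l0)//; lra.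
apply: le_trans h2.
have h : (1 - e) * (1 + e / 16) <= (1 - e / 2) * (1 - 4 * (e / 16)) by nra.
have := ler_wpM2r (ltW l0) h; lra.
Qed.

Lemma admissible_of_bounds (k e r b C : R) (t := e / 16)
    (W := \int[lam]_x (`|dev k (c_star k) x| * expR (- (b * x ^+ 2)))) :
  0 < c_star k -> - (c_star k * k) <= ln 2 ->
  \int[lam]_x (tilt k (c_star k) x * (x * phi0 x)) = 0 ->
  0 < e < 1 -> 0 < r < 1 -> 0 < b -> 0 <= C ->
  (forall q, -1 <= q <= 1 -> r <= `|q| -> Ent ((1 + q) / 2) <= e / 4 * ln 2) ->
  (forall q x y, `|q| <= r ->
    let w := C * (expR (- (b * x ^+ 2)) * expR (- (b * y ^+ 2))) in
    [/\ bvn_pdf q (x, y) <= w,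
      `|bvn_d1 q (x, y) * bvn_pdf q (x, y)| <= w &
      `|(bvn_d1 q (x, y) ^+ 2 + bvn_d2 q (x, y)) * bvn_pdf q (x, y)| <= w]) ->
  0 < Phi k <= t -> `|\int[N]_x dev k (c_star k) x| <= 2 * t ->
  \int[N]_x (dev k (c_star k) x ^+ 2) <= (1 + t) * Phi k ->
  8 * C * W ^+ 2 <= Phi k ->
  admissible k ((1 - e) * (ln 2 / Phi k)).
Proof.
move=> c0 ck M0 e01 r01 b0 C0 Er dom /andP[P0 Pt] mB S1 WP.
set m := \int[N]_x dev k (c_star k) x in mB *.
set S := \int[N]_x (dev k (c_star k) x ^+ 2) in S1 *.
set a := (1 - e) * (ln 2 / Phi k).
have l2 := @ln2_gt0 R.
have [e0 e1] := andP e01.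
have t0 : 0 < t by rewrite divr_gt0.
have t16 : t <= 16^-1 by rewrite /t; lra.
have a0 : 0 < a by rewrite mulr_gt0 ?divr_gt0// subr_gt0.
have aP : a * Phi k = (1 - e) * ln 2 by rewrite /a -mulrA divfK// gt_eqF.
have [m_pos F0_gt] := mean_bounds mB t16.
have F0E : pair_moment k 0 = (1 + m) ^+ 2 by exact: pair_moment0 (ltW c0) ck.
have F0_pos : 0 < (1 + m) ^+ 2 by rewrite exprn_gt0.
(* [a * Phi k = (1 - e) ln 2 <= 1], so the factor 8 in the hypothesis on [W] turns into this
   [1/8]. *)
have D8 : a * (C * W ^+ 2) <= 8^-1.
  rewrite -(ler_pM2l (ltr0n R 8)) divff//.
  have -> : 8 * (a * (C * W ^+ 2)) = a * (8 * C * W ^+ 2) by ring.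
  apply: le_trans (ler_wpM2l (ltW a0) WP) _; rewrite aP.
  have l1 : ln 2 <= 1 :> R by have := @ln_le_sub1 R 2 ltac:(lra); lra.
  by nra.
(* Positivity keeps [ln] off its default values: [S <= 2 t], so [1 + 2 m - S >= 1 - 6 t > 0]. The
   upper bound uses [1 + 2 m <= (1 + m)^2]. *)
have FU q : -1 <= q <= 1 ->
    0 < pair_moment k q /\ pair_moment k q <= (1 + m) ^+ 2 + S.
  move=> q1; rewrite (pair_moment_dev (ltW c0) ck q1) -/m.
  have := cross_moment_le (measurable_dev k (c_star k))
    (fun x => dev_le1 (ltW c0) ck x) q1.
  rewrite -/S ler_norml; move: (Rintegral _ _ _) => U /andP[h1 h2]; split.
    have h3 : (1 + t) * Phi k <= 2 * t by nra.
    have : - (2 * t) <= m by have : `|m| <= 2 * t by []; rewrite ler_norml => /andP[].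
    by lra.
  by have := sqr_ge0 m; nra.
split => //.
- move=> q q1 q0; rewrite /Psi F0E addr0 mul1r Ent_half.
  have [F_pos FS] := FU q q1.
  have [qr|rq] := ltP `|q| r.
    have qrI : `]-r, r[%classic q by rewrite /= in_itv/= -ltr_norml.
    have FG := pair_moment_growth c0 ck M0 r01 b0 C0 dom qrI.
    rewrite -/W in FG.
    have h1 := mul_ln_le (ltW a0) F_pos F0_pos FG.
    have h2 : Ent ((1 + q) / 2) <= ln 2 - q ^+ 2 / 4.
      apply: Ent_le; rewrite -ltr_norml; apply: lt_trans qr _.
      by have /andP[] := r01.
    have q2 : 0 < q ^+ 2 by rewrite exprn_even_gt0.
    have := small_q_bound q2 D8 t16 F0_gt; rewrite -mulrA in h1.
    by move: h1 h2; rewrite -!mulrA; lra.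
  (* For [|q| >= r] the gain is at most [(1 - e/2) ln 2] and the entropy at most [(e/4) ln 2]; the
     sum stays [(e/4) ln 2] below the entropy [ln 2] at [q = 0]. *)
  have h1 := mul_ln_le (ltW a0) F_pos F0_pos FS; have h2 := Er q q1 rq.
  have h3 : a * S <= (1 - e) * ln 2 * (1 + e / 16).
    apply: le_trans (ler_wpM2l (ltW a0) S1) _.
    by rewrite mulrCA aP mulrC.
  have h4 := large_q_bound e01 l2 F0_gt h3.
  have h5 : 0 < e * ln 2 by rewrite mulr_gt0.
  by lra.
- rewrite (derive2_Psi c0 ck M0 r01 b0 C0 dom m_pos) subr_lt0.
  have r00 : `]-r, r[%classic (0 : R).
    by rewrite /= in_itv/= oppr_lt0; have /andP[-> _] := r01.
  (* The same estimate [D8] settles the second derivative: [a U''(0) <= 1/8 < 3/4 <= (1 + m)^2]. *)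
  have := pairing_d2_le (measurable_dev k (c_star k))
    (fun x => dev_le1 (ltW c0) ck x) b0 dom r00.
  rewrite -/W => h; have {}h := le_trans (ler_norm _) h.
  rewrite mulrA ltr_pdivrMr// mul1r.
  apply: le_lt_trans (ler_wpM2l (ltW a0) h) _; apply: le_lt_trans D8 _.
  by apply: lt_le_trans F0_gt; lra.
Qed.

Lemma near_admissible (e : R) : 0 < e < 1 ->
  \forall k \near -oo%R, admissible k ((1 - e) * (ln 2 / Phi k)).
Proof.
move=> e01; have /andP[e0 e1] := e01.
have [r r01 Er] := @Ent_small R (e / 4 * ln 2)
  ltac:(by rewrite mulr_gt0 ?divr_gt0// ln2_gt0).
have [b [C [b4 C0 dom]]] := bvn_pdf_derivatives_dominated r01.
have b0 : 0 < b by lra.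
have t0 : 0 < e / 16 by lra.
have t1 : e / 16 <= 1 by lra.
near=> k.
have [c0 ck M0 Pt [mB S1]] : [/\ 0 < c_star k, - (c_star k * k) <= ln 2,
      \int[lam]_x (tilt k (c_star k) x * (x * phi0 x)) = 0,
      0 < Phi k <= e / 16 &
      `|\int[N]_x dev k (c_star k) x| <= 2 * (e / 16) /\
      \int[N]_x (dev k (c_star k) x ^+ 2) <= (1 + e / 16) * Phi k].
  by near: k; exact: near_regime.
apply: (@admissible_of_bounds k e r b C) => //.
by near: k; apply: dev_mass_dominated => //; rewrite mulr_ge0.
Unshelve. all: by end_near. Qed.

Lemma threshold_bounds (eps : R) : 0 < eps -> \forall k \near -oo%R,
  [/\ (((1 - eps) * (ln 2 / Phi k))%:E <= alpha_low k)%E,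
      (alpha_low k <= (alpha_up k)%:E)%E,
      alpha_up k <= (1 + eps) * (ln 2 / Phi k) & 0 < ln 2 / Phi k].
Proof.
(* [near_admissible] asks for [e < 1]; for larger [eps] the required lower bound is weaker than the
   one obtained for [e]. *)
move=> eps0; pose e := Num.min eps 2^-1.
have e01 : 0 < e < 1 by rewrite lt_min eps0 gt_min /=; apply/andP; split; lra.
near=> k.
have k0 : k <= 0 by near: k; exact: near_ninfty_le.
have P0 : 0 < Phi k by apply: lt_le_trans (Phi_ge k0); exact: normal_pdf01_gt0.
have L0 : 0 < ln 2 / Phi k by rewrite divr_gt0// ln2_gt0.
have [low up] : (alpha_low k <= (alpha_up k)%:E)%E /\ alpha_up k <= ln 2 / Phi k.
  by near: k; exact: alpha_low_le_up.
have adm : admissible k ((1 - e) * (ln 2 / Phi k)) by near: k; exact: near_admissible.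
split => //.
- apply: (@le_trans _ _ ((1 - e) * (ln 2 / Phi k))%:E).
    by rewrite lee_fin ler_pM2r// lerD2l lerN2 ge_min lexx.
  by apply: ereal_sup_ubound; exists ((1 - e) * (ln 2 / Phi k)).
- by apply: le_trans up _; rewrite ler_peMl ?ltW//; lra.
Unshelve. all: by end_near. Qed.

End main_bounds.

Theorem theorem2p5 (R : realType) :
  (forall eps : R, 0 < eps ->
     exists2 k0 : R, k0 < 0 &
       forall k : R, k <= k0 ->
         [/\ (((1 - eps) * (ln 2 / Phi k))%:E <= alpha_low k)%E,
             (alpha_low k <= (alpha_up k)%:E)%E &
             alpha_up k <= (1 + eps) * (ln 2 / Phi k)])
  /\
  (exists2 d : R -> R, d k @[k --> -oo%R] --> (0 : R) &
     \forall k \near -oo%R,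
       alpha_low k = ((1 + d k) * (ln 2 / Phi k))%:E)
  /\
  (exists2 d : R -> R, d k @[k --> -oo%R] --> (0 : R) &
     \forall k \near -oo%R, alpha_up k = (1 + d k) * (ln 2 / Phi k)).
Proof.
split; last split.
- move=> eps /threshold_bounds[M [_ HM]].
  (* Neighbourhoods of [-oo] are given by a strict inequality [k < M], hence [M - 1]; the entry [-1]
     makes the threshold negative. *)
  exists (Num.min (M - 1) (-1)); first by rewrite gt_min; apply/orP; right; lra.
  by move=> k; rewrite le_min => /andP[kM _]; have [] := HM k ltac:(lra).
(* The bounds at [eps = e] say that this relative error is at most [e] in absolute value. They also
   place [alpha_low] between two reals, so [fine] loses nothing. *)
- exists (fun k => fine (alpha_low k) / (ln 2 / Phi k) - 1).
    apply/cvgrPdist_le => e e0; near=> k.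
    have [h1 h2 h3 L0] : [/\ (((1 - e) * (ln 2 / Phi k))%:E <= alpha_low k)%E,
      (alpha_low k <= (alpha_up k)%:E)%E,
      alpha_up k <= (1 + e) * (ln 2 / Phi k) & 0 < ln 2 / Phi k].
      by near: k; exact: threshold_bounds.
    have : alpha_low k \is a fin_num.
      by rewrite fin_numE; case: (alpha_low k) h1 h2.
    case: (alpha_low k) h1 h2 => // x; rewrite !lee_fin => h1 h2 _ /=.
    rewrite sub0r normrN ler_norml.
    have := h1; rewrite -ler_pdivlMr// => h1'.
    have := le_trans h2 h3; rewrite -ler_pdivrMr// => h2'.
    by apply/andP; split; lra.
  near=> k.
  (* The value [eps = 1] is arbitrary: the bounds serve here to make [alpha_low] finite and the
     scale [ln 2 / Phi k] nonzero. *)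
  have [h1 h2 h3 L0] : [/\ (((1 - 1) * (ln 2 / Phi k))%:E <= alpha_low k)%E,
    (alpha_low k <= (alpha_up k)%:E)%E,
    alpha_up k <= (1 + 1) * (ln 2 / Phi k) & 0 < ln 2 / Phi k].
    by near: k; exact: threshold_bounds.
  rewrite addrC subrK divfK ?gt_eqF// fineK//.
  by rewrite fin_numE; case: (alpha_low k) h1 h2.
- exists (fun k => alpha_up k / (ln 2 / Phi k) - 1).
    apply/cvgrPdist_le => e e0; near=> k.
    have [h1 h2 h3 L0] : [/\ (((1 - e) * (ln 2 / Phi k))%:E <= alpha_low k)%E,
      (alpha_low k <= (alpha_up k)%:E)%E,
      alpha_up k <= (1 + e) * (ln 2 / Phi k) & 0 < ln 2 / Phi k].
      by near: k; exact: threshold_bounds.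
    have h4 := le_trans h1 h2; rewrite lee_fin -ler_pdivlMr// in h4.
    rewrite -ler_pdivrMr// in h3.
    by rewrite sub0r normrN ler_norml; apply/andP; split; lra.
  near=> k.
  have [_ _ _ L0] : [/\ (((1 - 1) * (ln 2 / Phi k))%:E <= alpha_low k)%E,
    (alpha_low k <= (alpha_up k)%:E)%E,
    alpha_up k <= (1 + 1) * (ln 2 / Phi k) & 0 < ln 2 / Phi k].
    by near: k; exact: threshold_bounds.
  by rewrite addrC subrK divfK ?gt_eqF.
Unshelve. all: by end_near. Qed.
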